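(* Let $M$ be a closed smooth manifold. Consider the signal-observation model $$dX_t = V_0(X_t)\,dt + \sum_{\alpha=1}^l V_\alpha(X_t)\circ dW_t^\alpha,\qquad dY_t = h(X_t)\,dt + dV_t,$$ with $X_t\in M$, $Y_t\in\mathbb{R}^m$, where the signal $X_t$ is a diffusion process on $M$ whose generator $L=\frac12\sum_{\alpha=1}^l V_\alpha^2+V_0$ has second-order term that is non-degenerate everywhere on $M$, and the observation function $h\colon M\to\mathbb{R}^m$ is smooth. Assume that $h$ is not a constant function. Then the estimation algebra $\mathcal{E}$ attached to this signal-observation model is infinite-dimensional.
   Context: Closed means compact without boundary. $V_0,V_1,\dots,V_l$ are smooth vector fields on $M$, regarded also as first-order differential operators on $C^\infty(M)$; $W^\alpha_t$ are standard one-dimensional Brownian motions, $V_t$ (with time index $t$, not one of the vector fields) is a standard $m$-dimensional Brownian motion, and $\circ$ denotes Stratonovich integration. All functions and operators are over the real numbers, and dimension means dimension as a real vector space. Non-degenerate diffusion process: $X_t$ is generated by $L$ in the sense that, for every $\phi\in C^\infty(M)$, the process $\phi(X_t)-\phi(X_0)-\int_0^t L\phi(X_s)\,ds$ is a martingale adapted to the underlying filtration, and $L$ is a second-order differential operator with smooth coefficients whose second-order part is everywhere non-degenerate: if in local coordinates the second-order part is $\frac12\sum_{i,j}a_{ij}(x)\partial_i\partial_j$ with $(a_{ij})$ symmetric, then the matrix $(a_{ij}(x))$ is invertible at every $x$. Riemannian metric attached to $L$: $M$ is given the Riemannian metric $g$ whose matrix in local coordinates is $(a_{ij})^{-1}$,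 so that $L=\frac12\Delta_{M}+F$, where $\Delta_M=\operatorname{div}_g\operatorname{grad}_g$ is the Laplace-Beltrami operator of $g$ and $F$ is a smooth vector field. Let $\omega$ be the canonical (Riemannian) measure of $g$ and $L^*$ the adjoint of $L$ with respect to $\omega$. Estimation algebra: $\mathcal{E}$ is the Lie algebra, under the commutator $[D_1,D_2]=D_1D_2-D_2D_1$, inside the algebra of smooth differential operators on $M$ generated by $L_0,L_1,\dots,L_m$, where $L_0=L^*-\frac12 h^\top h$ (the function $h^\top h=\sum_{i=1}^m (h^i)^2$ acting by multiplication) and, for $1\le i\le m$, $L_i$ is multiplication by the $i$-th component $h^i$ of $h$.
   Formalization: The closed manifold M is assumed connected; otherwise the claim fails: on two disjoint circles, h equal to 0 on one and 1 on the other is non-constant but commutes with L*, so the estimation algebra has dimension at most 2. *)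

(* Defs.v *)
From HB Require Import structures.
From mathcomp Require Import all_boot all_order all_algebra.
From mathcomp Require Import all_classical all_reals all_analysis.

Set Implicit Arguments.
Unset Strict Implicit.
Unset Printing Implicit Defensive.

Import Order.TTheory GRing.Theory Num.Theory.
Import numFieldNormedType.Exports.

Local Open Scope classical_set_scope.
Local Open Scope ring_scope.

Definition partial (R : realType) n (i : 'I_n) (f : 'rV[R]_n -> R)
  : 'rV[R]_n -> R := fun u => 'D_(delta_mx 0 i) f u.

(* U is meant to be open: f is a total function, and only its germs at
   the points of U matter. *)
Fixpoint Ck_on (R : realType) n (k : nat) (U : set 'rV[R]_n)
    (f : 'rV[R]_n -> R) : Prop :=
  (forall u, U u -> {for u, continuous f}) /\
  (if k is k'.+1 then
     forall i : 'I_n,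
       (forall u, U u -> derivable f u (delta_mx 0 i)) /\
       Ck_on k' U (partial i f)
   else True).

Definition smooth_on (R : realType) n (U : set 'rV[R]_n) (f : 'rV[R]_n -> R) :=
  forall k, Ck_on k U f.

(* cmap and cinv are total functions; only their restrictions to cdom and to
   its image are meaningful. *)
Record chart (R : realType) n (M : ptopologicalType) := Chart {
  cdom : set M;
  cmap : M -> 'rV[R]_n;
  cinv : 'rV[R]_n -> M;
  cdom_open : open cdom;
  cimg_open : open (cmap @` cdom);
  cmapK : forall x, cdom x -> cinv (cmap x) = x;
  cmap_continuous : forall x, cdom x -> {for x, continuous cmap};
  cinv_continuous : forall u, (cmap @` cdom) u -> {for u, continuous cinv} }.

Definition cimg (R : realType) n (M : ptopologicalType) (c : chart R n M) :
  set 'rV[R]_n := cmap c @` cdom c.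

Record smooth_atlas (R : realType) n (M : ptopologicalType) := SmoothAtlas {
  charts : set (chart R n M);
  charts_cover : forall x : M, exists2 c, charts c & cdom c x;
  charts_compat : forall c1 c2, charts c1 -> charts c2 -> forall i : 'I_n,
    smooth_on (cmap c1 @` (cdom c1 `&` cdom c2))
              (fun u => cmap c2 (cinv c1 u) 0 i) }.

(* Charts take values in open subsets of R^n, so there is no boundary. Second
   countability follows from compactness. Manifolds are taken to be connected:
   otherwise a locally constant h on two components would generate, together
   with L_0, an algebra of dimension at most 2. *)
Definition closed_manifold (R : realType) n (M : ptopologicalType)
    (A : smooth_atlas R n M) :=
  [/\ hausdorff_space M, compact [set: M] & connected [set: M]].

Definition loc (R : realType) n (M : ptopologicalType) (c : chart R n M)
  (f : M -> R) : 'rV[R]_n -> R := fun u => f (cinv c u).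

Definition smooth_on_manifold (R : realType) n (M : ptopologicalType)
    (A : smooth_atlas R n M) (f : M -> R) :=
  forall c, charts A c -> smooth_on (cimg c) (loc c f).

Section Ck_closed.
Variables (R : realType) (n : nat) (U : set 'rV[R]_n).
Hypothesis oU : open U.

Lemma eq_Ck_on k (f g : 'rV[R]_n -> R) :
  (forall u, U u -> f u = g u) -> Ck_on k U f -> Ck_on k U g.
Proof.
elim: k f g => [|k IH] f g fg [fC fD].
all: have near_fg u : U u -> {near u, f =1 g}
  by move=> Uu; apply: filterS fg _; exact: open_nbhs_nbhs.
all: have gC u : U u -> {for u, continuous g}
  by move=> Uu; rewrite /prop_for /continuous_at -(fg u Uu);
     apply: cvg_trans (fC u Uu);
     exact: (near_eq_cvg (F := nbhs u) (near_fg u Uu)).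
- by split.
- split=> // i; have [fd fk] := fD i; split=> [u Uu|].
    exact: near_eq_derivable (near_fg u Uu) (fd u Uu).
  by apply: IH fk => u Uu; apply: near_eq_derive; exact: near_fg.
Qed.

Lemma Ck_onS k (f : 'rV[R]_n -> R) : Ck_on k.+1 U f -> Ck_on k U f.
Proof.
elim: k f => [|k IH] f [fC fD]; split=> // i.
by have [fd fk] := fD i; split=> //; exact: IH.
Qed.

Lemma Ck_on_cst k (a : R) : Ck_on k U (cst a).
Proof.
elim: k a => [|k IH] a; split=> //.
- by move=> u _; exact: cst_continuous.
- by move=> u _; exact: cst_continuous.
- move=> i; split=> [u _|]; first exact: derivable_cst.
  apply: eq_Ck_on (IH 0) => u _.
  by rewrite /partial derive_cst.
Qed.

Lemma Ck_onD k (f g : 'rV[R]_n -> R) :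
  Ck_on k U f -> Ck_on k U g -> Ck_on k U (f + g).
Proof.
elim: k f g => [|k IH] f g [fC fD] [gC gD]; split=> //.
- by move=> u Uu; exact: (cvgD (fC u Uu) (gC u Uu)).
- by move=> u Uu; exact: (cvgD (fC u Uu) (gC u Uu)).
- move=> i; have [fd fk] := fD i; have [gd gk] := gD i; split=> [u Uu|].
    by apply: derivableD; [exact: fd|exact: gd].
  apply: eq_Ck_on (IH _ _ fk gk) => u Uu.
  by rewrite /partial deriveD//; [exact: fd|exact: gd].
Qed.

Lemma Ck_onM k (f g : 'rV[R]_n -> R) :
  Ck_on k U f -> Ck_on k U g -> Ck_on k U (f * g).
Proof.
elim: k f g => [|k IH] f g fk gk.
  move: fk gk => [fC _] [gC _]; split=> // u Uu.
  by exact: (cvgM (fC u Uu) (gC u Uu)).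
have [fS gS] := (Ck_onS fk, Ck_onS gk).
move: fk gk => [fC fD] [gC gD]; split=> [u Uu|i].
  by exact: (cvgM (fC u Uu) (gC u Uu)).
have [fd fk] := fD i; have [gd gk] := gD i; split=> [u Uu|].
  by apply: derivableM; [exact: fd|exact: gd].
apply: eq_Ck_on (Ck_onD (IH _ _ fS gk) (IH _ _ gS fk)) => u Uu.
by rewrite /partial deriveM//; [exact: fd|exact: gd].
Qed.

End Ck_closed.

Section smooth_functions.
Variables (R : realType) (n : nat) (M : ptopologicalType)
  (A : smooth_atlas R n M).

Definition smoothp : {pred M -> R} :=
  fun f => `[< smooth_on_manifold A f >].

Lemma smoothpP f : reflect (smooth_on_manifold A f) (f \in smoothp).
Proof. exact: asboolP. Qed.

Lemma smoothp_cst (a : R) : cst a \in smoothp.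
Proof. by apply/smoothpP => c _ k; apply: Ck_on_cst; exact: cimg_open. Qed.

Lemma smoothpD f g : f \in smoothp -> g \in smoothp -> f + g \in smoothp.
Proof.
move=> /smoothpP sf /smoothpP sg; apply/smoothpP => c Ac k.
apply: (Ck_onD (@cimg_open _ _ _ c) (f := loc c f) (g := loc c g)).
  exact: sf.
exact: sg.
Qed.

Lemma smoothpM f g : f \in smoothp -> g \in smoothp -> f * g \in smoothp.
Proof.
move=> /smoothpP sf /smoothpP sg; apply/smoothpP => c Ac k.
apply: (Ck_onM (@cimg_open _ _ _ c) (f := loc c f) (g := loc c g)).
  exact: sf.
exact: sg.
Qed.

Lemma smoothpZ (a : R) (f : M -> R) : f \in smoothp -> a *: f \in smoothp.
Proof. by move=> sf; exact: (smoothpM (smoothp_cst a) sf). Qed.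

Lemma smoothp_submod_closed : submod_closed smoothp.
Proof.
split; first exact: (smoothp_cst 0).
by move=> a f g sf sg; apply: smoothpD => //; exact: smoothpZ.
Qed.

Lemma smoothp_subring_closed : subring_closed smoothp.
Proof.
split; first exact: (smoothp_cst 1).
- move=> f g sf sg; apply: smoothpD => //.
  by rewrite -scaleN1r; exact: smoothpZ.
- exact: smoothpM.
Qed.

HB.instance Definition _ := GRing.isSubringClosed.Build (M -> R) smoothp
  smoothp_subring_closed.
HB.instance Definition _ := GRing.isSubmodClosed.Build R (M -> R) smoothp
  smoothp_submod_closed.

Record smooth_fun := SmoothFun { sfun_val :> M -> R; _ : sfun_val \in smoothp }.

HB.instance Definition _ := [isSub for sfun_val].
HB.instance Definition _ := [Choice of smooth_fun by <:].
HB.instance Definition _ := GRing.SubChoice_isSubComPzRing.Build (M -> R) smoothp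
  smooth_fun smoothp_subring_closed.
HB.instance Definition _ := [SubZmodule_isSubLmodule of smooth_fun by <:].

End smooth_functions.

Section operators.
Variables (R : realType) (n : nat) (M : ptopologicalType)
  (A : smooth_atlas R n M).
Local Notation C := (smooth_fun A).

(* A smooth vector field is identified with the operator that it induces. *)
Definition vector_field (V : C -> C) :=
  forall c, charts A c -> exists v : 'I_n -> 'rV[R]_n -> R,
    (forall i, smooth_on (cimg c) (v i)) /\
    (forall (f : C) u, cimg c u ->
       V f (cinv c u) = \sum_i v i u * partial i (loc c f) u).

Definition generator l (V0 : C -> C) (V : 'I_l -> C -> C) : C -> C :=
  fun f => 2^-1 *: (\sum_a V a (V a f)) + V0 f.

(* Symmetry makes L determine a on cimg c. *)
Definition second_order_part (L : C -> C) (c : chart R n M)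
    (a : 'rV[R]_n -> 'M[R]_n) :=
  (forall i j, smooth_on (cimg c) (fun u => a u i j)) /\
  (forall u, cimg c u -> (a u)^T = a u) /\
  exists (b : 'I_n -> 'rV[R]_n -> R) (e : 'rV[R]_n -> R),
    (forall i, smooth_on (cimg c) (b i)) /\ smooth_on (cimg c) e /\
    (forall (f : C) u, cimg c u ->
       L f (cinv c u) =
         2^-1 * (\sum_i \sum_j a u i j * partial i (partial j (loc c f)) u)
         + \sum_i b i u * partial i (loc c f) u + e u * loc c f u).

Definition nondegenerate_operator (L : C -> C) :=
  forall c, charts A c -> exists a, second_order_part L c a /\
    forall u, cimg c u -> a u \in unitmx.

Definition attached_metric (L : C -> C)
    (g : chart R n M -> 'rV[R]_n -> 'M[R]_n) :=
  forall c, charts A c -> exists a, second_order_part L c a /\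
    forall u, cimg c u -> a u \in unitmx /\ g c u = invmx (a u).

Definition borel (T : ptopologicalType) := g_sigma_algebraType (@open T).

(* Integration against Lebesgue measure on R^k, as an iterated integral (used
   for nonnegative functions only). *)
Fixpoint integral_rV k : ('rV[R]_k -> \bar R) -> \bar R :=
  match k with
  | 0 => fun f => f 0
  | k'.+1 => fun f =>
      (\int[lebesgue_measure]_x
         integral_rV (fun y : 'rV[R]_k' => f (row_mx (x%:M : 'rV_1) y)))%E
  end.

(* In a chart the Riemannian measure is sqrt (det g) du_1 ... du_n. *)
Definition riemannian_measure (g : chart R n M -> 'rV[R]_n -> 'M[R]_n)
    (omega : {measure set (borel M) -> \bar R}) :=
  forall c, charts A c -> forall B : set (borel M), measurable B ->
    B `<=` cdom c ->
    omega B = integral_rV (fun u =>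
      (\1_(cmap c @` (B : set M)) u * Num.sqrt (\det (g c u)))%:E).

Definition adjoint_operator (omega : {measure set (borel M) -> \bar R})
    (L Lstar : C -> C) :=
  forall f k : C, (\int[omega]_x (L f x * k x) =
                   \int[omega]_x (f x * Lstar k x))%R.

(* The ring structure that C -> C inherits from C is pointwise; the product of
   operators is composition. *)
Definition op_commutator (D1 D2 : C -> C) : C -> C :=
  fun f => D1 (D2 f) - D2 (D1 f).

Definition multiplication (f : C) : C -> C := fun k => f * k.

Definition lie_subalgebra (S : set (C -> C)) :=
  [/\ S 0,
      forall (r : R) D1 D2, S D1 -> S D2 -> S (r *: D1 + D2) &
      forall D1 D2, S D1 -> S D2 -> S (op_commutator D1 D2)].

(* The generators are L_0 = L^* - |h|^2 / 2 and L_i = h^i. *)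
Definition estimation_algebra m (Lstar : C -> C) (h : 'I_m -> C) :
    set (C -> C) :=
  smallest lie_subalgebra
    [set D | D = Lstar - multiplication (2^-1 *: \sum_i h i ^+ 2) \/
             exists i, D = multiplication (h i)].

Definition infinite_dimensional (S : set (C -> C)) :=
  ~ exists k (e : 'I_k -> C -> C), (forall i, S (e i)) /\
    forall D, S D -> exists r : 'I_k -> R, D = \sum_i r i *: e i.

End operators.

Section processes.
Context {R : realType} {d : measure_display} {Omega : measurableType d}.
Variable P : probability Omega R.

(* Processes are indexed by R, but only times t >= 0 are meaningful. *)
Definition filtration (F : R -> set (set Omega)) :=
  [/\ forall t, 0 <= t -> sigma_algebra setT (F t),
      forall t, 0 <= t -> F t `<=` measurable &
      forall s t, 0 <= s -> s <= t -> F s `<=` F t].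

Definition adapted (F : R -> set (set Omega)) d' (T : measurableType d')
    (Z : R -> Omega -> T) :=
  forall t, 0 <= t -> forall B, measurable B -> F t (Z t @^-1` B).

Definition continuous_paths (T : topologicalType) (Z : R -> Omega -> T) :=
  forall w, {within `[0, +oo[, continuous (fun t => Z t w)}.

Definition martingale (F : R -> set (set Omega)) (N : R -> Omega -> R) :=
  [/\ adapted F N,
      forall t, 0 <= t -> P.-integrable setT (EFin \o N t) &
      forall s t, 0 <= s -> s <= t -> forall E, F s E ->
        (\int[P]_(w in E) N t w = \int[P]_(w in E) N s w)%R].

(* Over [s, t] the increments of the k components are centered Gaussian with
   variance t - s, jointly independent of each other and of F s. *)
Definition brownian_motion (F : R -> set (set Omega)) k
    (W : 'I_k -> R -> Omega -> R) :=
  [/\ filtration F,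
      forall i, adapted F (W i),
      forall i, continuous_paths (W i),
      forall i, {ae P, forall w, W i 0 w = 0} &
      forall s t, 0 <= s -> s < t -> forall E, F s E ->
      forall B : 'I_k -> set R, (forall i, measurable (B i)) ->
        (P (E `&` [set w | forall i, B i (W i t w - W i s w)%R]) =
         P E * \prod_i normal_prob 0 (Num.sqrt (t - s)%R) (B i))%E].

Definition natural_filtration k (W : 'I_k -> R -> Omega -> R) :
    R -> set (set Omega) := fun t =>
  <<s [set E | exists i s B, [/\ 0 <= s, s <= t, measurable B &
                                 E = W i s @^-1` B]] >>.

Definition stratonovich_sum (Z W : R -> Omega -> R) (N : nat) (p : nat -> R)
    (w : Omega) : R :=
  \sum_(j < N) (Z (p j) w + Z (p j.+1) w) / 2 * (W (p j.+1) w - W (p j) w).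

(* I is the Stratonovich integral of Z against W over [0, t]: the limit in
   probability of the symmetric sums as the mesh of the partition tends to 0. *)
Definition stratonovich_integral (Z W : R -> Omega -> R) (t : R)
    (I : Omega -> R) :=
  measurable_fun setT I /\
  forall eps : R, 0 < eps -> exists2 delta : R, 0 < delta &
    forall (N : nat) (p : nat -> R), p 0%N = 0 -> p N = t ->
      (forall j, (j < N)%N -> 0 <= p j.+1 - p j < delta) ->
      (P [set w | eps <= `|stratonovich_sum Z W N p w - I w|]%R <= eps%:E)%E.

End processes.

Section model.
Context {R : realType} {n : nat} {M : ptopologicalType}.
Context {A : smooth_atlas R n M}.
Context {d : measure_display} {Omega : measurableType d}.
Variable P : probability Omega R.
Local Notation C := (smooth_fun A).

Definition time_integral (f : M -> R) (X : R -> Omega -> M) (t : R)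
    (w : Omega) : R :=
  (\int[lebesgue_measure]_(s in `[0, t]) f (X s w))%R.

(* dX = V0(X) dt + sum_a V_a(X) o dW^a on M, tested against smooth functions:
   df(X) = (V0 f)(X) dt + sum_a (V_a f)(X) o dW^a. *)
Definition stratonovich_sde l (V0 : C -> C) (V : 'I_l -> C -> C)
    (X : R -> Omega -> M) (W : 'I_l -> R -> Omega -> R) :=
  forall (f : C) t, 0 <= t -> exists I : 'I_l -> Omega -> R,
    (forall a, stratonovich_integral P (fun s w => V a f (X s w)) (W a) t
                 (I a)) /\
    {ae P, forall w, f (X t w) = f (X 0 w) + time_integral (V0 f) X t w
                                 + \sum_a I a w}.

Definition generated_by (F : R -> set (set Omega)) (L : C -> C)
    (X : R -> Omega -> M) :=
  forall f : C, martingale P F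
    (fun t w => f (X t w) - f (X 0 w) - time_integral (L f) X t w).

(* B is the Brownian motion driving the observation Y. *)
Record signal_observation_model l m (V0 : C -> C) (V : 'I_l -> C -> C)
    (h : 'I_m -> C) (F : R -> set (set Omega)) (X : R -> Omega -> M)
    (W : 'I_l -> R -> Omega -> R) (Y B : 'I_m -> R -> Omega -> R) : Prop := {
  model_signal_adapted : adapted F (X : R -> Omega -> borel M);
  model_signal_continuous : continuous_paths X;
  model_signal_noise : brownian_motion P F W;
  model_signal_sde : stratonovich_sde V0 V X W;
  model_signal_generator : generated_by F (generator V0 V) X;
  model_observation_noise : brownian_motion P (natural_filtration B) B;
  model_observation_measurable : forall i t, 0 <= t ->
    measurable_fun setT (Y i t);
  model_observation : forall i t, 0 <= t ->
    {ae P, forall w, Y i t w = Y i 0 w + time_integral (h i) X t w + B i t w}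
}.

End model.

(* Main.v *)
Require Import Defs.
From HB Require Import structures.
From mathcomp Require Import all_boot all_order all_algebra.
From mathcomp Require Import all_classical all_reals all_analysis.
From mathcomp Require Import measurable_realfun.
From mathcomp Require Import ring lra.
From mathcomp Require polyrcf.

Set Implicit Arguments.
Unset Strict Implicit.
Unset Printing Implicit Defensive.

Import Order.TTheory GRing.Theory Num.Theory.
Import numFieldNormedType.Exports.

Local Open Scope classical_set_scope.
Local Open Scope ring_scope.

(** Suppose that the estimation algebra is finite-dimensional, and write
    Gamma f g = sum_a (V_a f) (V_a g) for the carre du champ of the generator L.
    The double commutator of L with multiplications by f and g is
    multiplication by Gamma f g (generator_double_commutator), and the same is
    true of the adjoint of L (adjoint_double_commutator).  The algebra therefore
    contains multiplication by X^j phi for every j, where phi is a component of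
    h and X is the derivation Gamma phi, so the functions X^j phi are linearly
    dependent.

    The maximum principle then kills phi.  As M is compact, every smooth
    function has a maximum, and a derivation vanishes there.  If X (X psi) >= 0,
    evaluating X (N X psi + psi) and X (- N X psi + psi) at the maximum of the
    function to which X is applied, for N large, forces X psi = 0
    (second_derivative_ge0_eq0).  In particular X^2 and X have the same kernel,
    so a dependence relation among the X^j phi with j >= 1 turns into
    X phi = X (X psi) for some psi (image_in_second_image).  Since
    X phi = sum_a (V_a phi)^2 >= 0, the principle applies to psi and gives
    X phi = 0.  Hence every V_a phi vanishes, so d phi = 0 because L is
    nondegenerate, and phi is constant because M is connected.  This replaces
    the flow of the gradient of phi, along which phi would be both monotone and
    almost periodic.

    Two points need an argument.
    - The symbol a of L is positive definite with a(d f, d f) = sum_a (V_a f)^2.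
      Both sides are compared on L (f^2) at a zero of f, which needs globally
      smooth functions with a prescribed differential at a point
      (smooth_fun_with_differential).  They are built from products of bumps in
      each coordinate separately, so that only the chain rule in one variable is
      needed to see that they are smooth in the other charts.
    - The adjoint of L is known only through its pairing with smooth functions.
      The difference u of the two sides of adjoint_double_commutator is
      orthogonal to every smooth function, hence to itself, so u = 0 once
      omega is finite and charges every nonempty open set.  Both properties
      are local (riemannian_measure_local): near a point the density
      sqrt (det g) lies between two positive constants, and the measure is
      compared with that of a cube. *)

(** * Flat functions on the line *)

Section flat_functions.
Variable R : realType.
Implicit Types (p : {poly R}) (s t : R).

(** The derivatives of exp (- 1 / t) on t > 0 are of the form
    p (1 / t) exp (- 1 / t), so the family indexed by the polynomial p is closed
    under differentiation. *)
Definition flat p t : R := if 0 < t then p.[t^-1] * expR (- t^-1) else 0.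

Definition flat_deriv p : {poly R} := 'X^2 * (p - p^`()).

Lemma horner_le_expR p :
  exists2 K : R, 0 <= K & forall s, 0 <= s -> `|p.[s]| <= K * expR s.
Proof.
exists (\sum_(i < size p) `|p`_i| * i`!%:R).
  by apply: sumr_ge0 => i _; rewrite mulr_ge0.
move=> s s0; rewrite horner_coef mulr_suml.
apply: le_trans (ler_norm_sum _ _ _) _; apply: ler_sum => i _.
rewrite normrM -mulrA ler_wpM2l// ger0_norm ?exprn_ge0//.
rewrite mulrC -ler_pdivrMr ?ltr0n ?fact_gt0//.
case: (nat_of_ord i) => [|k].
  by rewrite expr0 fact0 divr1; apply: le_trans (expR_ge1Dx s); rewrite lerDl.
by apply: le_trans (expR_ge1Dxn k s0); rewrite lerDr.
Qed.

Lemma flat_eq0 p t : t <= 0 -> flat p t = 0.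
Proof. by rewrite /flat leNgt => /negbTE ->. Qed.

(** The bound on p X by a multiple of exp gains the factor t that makes flat p
    continuous at 0; applied to p X again, it makes flat p differentiable
    there. *)
Lemma flat_bound p : exists2 K : R, 0 <= K & forall t, `|flat p t| <= K * `|t|.
Proof.
have [K K0 KP] := horner_le_expR (p * 'X).
exists K => // t; rewrite /flat; case: ifPn => [t0|_]; last first.
  by rewrite normr0 mulr_ge0.
have := KP t^-1; rewrite invr_ge0 => /(_ (ltW t0)).
rewrite hornerM hornerX !normrM expRN (gtr0_norm t0).
rewrite (ger0_norm (_ : 0 <= t^-1)) ?invr_ge0 ?(ltW t0)//.
rewrite (ger0_norm (_ : 0 <= (expR _)^-1)) ?invr_ge0 ?expR_ge0//.
by rewrite ler_pdivrMr// ler_pdivrMr ?expR_gt0// mulrAC.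
Qed.

Lemma flat_continuous0 p : {for 0, continuous (flat p)}.
Proof.
have [K K0 KP] := flat_bound p.
rewrite /prop_for /continuous_at flat_eq0//.
apply/cvgr0Pnorm_le => e e0; near=> t.
apply: le_trans (KP t) _.
apply: (@le_trans _ _ ((K + 1) * `|t|)); first by rewrite ler_wpM2r// lerDl.
rewrite mulrC -ler_pdivlMr ?ltr_wpDl//.
near: t; apply: (@cvgr0_norm_le _ _ _ (nbhs (0 : R)) _ id cvg_id).
by rewrite divr_gt0// ltr_wpDl.
Unshelve. all: by end_near. Qed.

Lemma is_derive_flat p t : is_derive t 1 (flat p) (flat (flat_deriv p) t).
Proof.
have [t0|t0|->] := ltgtP t 0.
- rewrite flat_eq0 ?(ltW t0)//.
  apply: (@near_eq_is_derive _ _ _ (cst 0)).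
  near=> z; rewrite flat_eq0//; apply: ltW; near: z; exact: lt_nbhsl.
- have tn0 : t != 0 by rewrite gt_eqF.
  have di : is_derive t (1 : R) (fun z : R => z^-1) (- t ^- 2).
    apply: is_derive_eq;
      first exact: (@is_deriveV _ id _ _ _ tn0 (is_derive_id _ _)).
    by rewrite /GRing.scale/= mulr1.
  have dp := @is_derive1_comp _ (horner p) _ t _ _ (is_derive_poly p t^-1) di.
  have dm : is_derive t (1 : R) (fun z : R => - z^-1) (t ^- 2).
    by apply: is_derive_eq; rewrite opprK.
  have de := @is_derive1_comp _ expR _ t _ _ (is_derive_expR _) dm.
  have nE : {near t, (fun z => p.[z^-1] * expR (- z^-1)) =1 flat p}.
    by near=> z; rewrite /flat ifT//; near: z; exact: lt_nbhsr.
  apply: (near_eq_is_derive nE).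
  have D := is_deriveM dp de; apply: (is_derive_eq D).
  rewrite /flat t0 /flat_deriv hornerM hornerXn hornerD hornerN /GRing.scale/=.
  by field.
- rewrite flat_eq0//; apply/is_derive1_caratheodory.
  (* Division by t turns flat p into flat (p * 'X). *)
  exists (flat (p * 'X)); split; last 2 first.
  + exact: flat_continuous0.
  + by rewrite flat_eq0.
  move=> z; rewrite subr0 (flat_eq0 p (lexx 0)) subr0 /flat.
  case: ifPn => z0; last by rewrite mul0r.
  have zn0 : z != 0 by rewrite gt_eqF.
  rewrite hornerM hornerX; field; exact: zn0.
Unshelve. all: by end_near. Qed.

End flat_functions.

(** * Calculus along coordinate directions *)

Section directional_calculus.
Variables (R : realType) (n : nat).
Implicit Types (u v : 'rV[R]_n) (U : set 'rV[R]_n).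

(** Reduces directional derivatives to derivatives in one variable, for which
    the chain rule, Fermat's rule and the mean value theorem are available. *)
Lemma is_derive_line (f : 'rV[R]_n -> R) u v (s d : R) :
  is_derive (s *: v + u) v f d <->
  is_derive s 1 (fun t : R => f (t *: v + u)) d.
Proof.
have E : (fun h : R => h^-1 *: ((f \o shift (s *: v + u)) (h *: v) -
                                f (s *: v + u))) =
  (fun h : R => h^-1 *: (((fun t : R => f (t *: v + u)) \o shift s) (h *: 1) -
                         f (s *: v + u))).
  apply/funext => h /=; congr (_ *: (f _ - _)).
  by rewrite addrA -scalerDl [_%:A]mulr1.
by split=> -[D1 D2]; split; rewrite ?/derivable ?/derive ?E// -?E.
Qed.

Lemma is_derive_dcomp (f : 'rV[R]_n -> R) (g : R -> R) u v (d e : R) :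
  is_derive u v f d -> is_derive (f u) 1 g e -> is_derive u v (g \o f) (e * d).
Proof.
have u0 : (0 : R) *: v + u = u by rewrite scale0r add0r.
rewrite -{1 3}u0 => /is_derive_line Df Dg; apply/is_derive_line.
by apply: is_derive1_comp => //=; rewrite u0.
Qed.

Lemma Ck_on_continuous k U (f : 'rV[R]_n -> R) u :
  Ck_on k U f -> U u -> {for u, continuous f}.
Proof. by case: k => [|k] [fC _]; exact: fC. Qed.

Lemma Ck_on_derivable k U (f : 'rV[R]_n -> R) u i :
  Ck_on k.+1 U f -> U u -> is_derive u (delta_mx 0 i) f (partial i f u).
Proof. by move=> [_ /(_ i)[fd _]] Uu; apply: derivableP; exact: fd. Qed.

Lemma Ck_on_local k U (f : 'rV[R]_n -> R) :
  (forall u, U u -> exists W, W u /\ Ck_on k W f) -> Ck_on k U f.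
Proof.
elim: k f => [|k IH] f H.
  by split=> // u /H[W [Wu [fC _]]]; exact: fC.
split=> [u /H[W [Wu [fC _]]]|i]; first exact: fC.
split=> [u /H[W [Wu [_ /(_ i)[fd _]]]]|]; first exact: fd.
by apply: IH => u /H[W [Wu [_ /(_ i)[_ fk]]]]; exists W.
Qed.

(** By induction on k for all p at once: the derivative of flat p is another
    flat function. *)
Lemma Ck_on_flat k U (p : {poly R}) (f : 'rV[R]_n -> R) : open U ->
  Ck_on k U f -> Ck_on k U (flat p \o f).
Proof.
move=> oU; elim: k p f => [|k IH] p f fk.
all: have cf u : U u -> {for u, continuous (flat p \o f)}.
all: try (move=> Uu; apply: continuous_comp;
  [exact: Ck_on_continuous fk Uu|];
  apply: differentiable_continuous; apply/derivable1_diffP;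
  by have [] := is_derive_flat p (f u)).
- by split.
- have D u i : U u -> is_derive u (delta_mx 0 i) (flat p \o f)
      (flat (flat_deriv p) (f u) * partial i f u).
    move=> Uu; apply: is_derive_dcomp; last exact: is_derive_flat.
    exact: Ck_on_derivable fk Uu.
  split=> // i; split=> [u Uu|]; first by have [] := D u i Uu.
  have [_ /(_ i)[_ fik]] := fk.
  apply: eq_Ck_on (Ck_onM oU (IH (flat_deriv p) f (Ck_onS fk)) fik) => // u Uu.
  by have [_ DE] := D u i Uu; rewrite /partial DE.
Qed.

Lemma is_derive_coord u i j :
  is_derive u (delta_mx 0 i) (fun v : 'rV[R]_n => v 0 j) (i == j)%:R.
Proof.
have u0 : (0 : R) *: delta_mx 0 i + u = u by rewrite scale0r add0r.
rewrite -{1}u0; apply/is_derive_line.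
have -> : (fun t : R => (t *: delta_mx 0 i + u) 0 j) =
          (fun t : R => (i == j)%:R * t + u 0 j).
  by apply/funext => t; rewrite !mxE eqxx/= eq_sym mulrC.
by apply: is_derive_eq; rewrite addr0 /GRing.scale/= mulr1.
Qed.

Lemma Ck_on_coord k U j : open U -> Ck_on k U (fun v : 'rV[R]_n => v 0 j).
Proof.
move=> oU; case: k => [|k]; (split; first by move=> u _;
  exact: coord_continuous) => // i.
split=> [u _|]; first by have [] := is_derive_coord u i j.
apply: eq_Ck_on (Ck_on_cst oU k ((i == j)%:R)) => // u _.
by have [_ <-] := is_derive_coord u i j.
Qed.

Lemma Ck_on_sum k U (I : Type) (r : seq I) (F : I -> 'rV[R]_n -> R) : open U ->
  (forall i, Ck_on k U (F i)) -> Ck_on k U (fun u => \sum_(i <- r) F i u).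
Proof.
move=> oU FU; elim: r => [|i r IH].
  by apply: eq_Ck_on (Ck_on_cst oU k 0) => // u _; rewrite big_nil.
by apply: eq_Ck_on (Ck_onD oU (FU i) IH) => // u _; rewrite big_cons.
Qed.

Lemma Ck_on_prod k U (I : Type) (r : seq I) (F : I -> 'rV[R]_n -> R) : open U ->
  (forall i, Ck_on k U (F i)) -> Ck_on k U (fun u => \prod_(i <- r) F i u).
Proof.
move=> oU FU; elim: r => [|i r IH].
  by apply: eq_Ck_on (Ck_on_cst oU k 1) => // u _; rewrite big_nil.
by apply: eq_Ck_on (Ck_onM oU (FU i) IH) => // u _; rewrite big_cons.
Qed.

Definition cube u (e : R) : set 'rV[R]_n :=
  [set v | forall j, `|v 0 j - u 0 j| < e].

Lemma cubeP u U : nbhs u U -> exists2 e : R, 0 < e & cube u e `<=` U.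
Proof.
move=> /nbhs_ballP[e/= e0 eU]; exists e => // v uv.
by apply: eU; split=> // i j; rewrite ord1 /ball/= distrC; exact: uv.
Qed.

Lemma cube_open u e : open (cube u e).
Proof.
rewrite openE => v uv.
have [n0|n0] := posnP n.
  have vE w : w = v by apply/rowP => -[j jn]; exfalso; move: jn; rewrite n0.
  by apply/nbhs_ballP; exists 1 => //= w _ j; rewrite (vE w).
pose e' := \big[Order.min/1]_j (e - `|v 0 j - u 0 j|).
have e'0 : 0 < e' by apply: lt_bigmin => // j _; rewrite subr_gt0.
apply/nbhs_ballP; exists e' => //= w [_ vw] j.
have := vw 0 j; rewrite /ball/= => /lt_le_trans => /(_ (e - `|v 0 j - u 0 j|)).
have le : e' <= e - `|v 0 j - u 0 j| by apply: bigmin_le.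
move=> /(_ le); rewrite ltrBrDr => /(le_lt_trans _); apply.
have -> : w 0 j - u 0 j = - (v 0 j - w 0 j) + (v 0 j - u 0 j) by ring.
by rewrite (le_trans (ler_normD _ _))// normrN.
Qed.

Lemma cube_center u e : 0 < e -> cube u e u.
Proof. by move=> e0 j; rewrite subrr normr0. Qed.

Lemma partial_at_max U (f : 'rV[R]_n -> R) u i : open U -> U u ->
  Ck_on 1 U f -> (forall v, U v -> f v <= f u) -> partial i f u = 0.
Proof.
move=> oU Uu fk fmax.
have [e e0 eU] := cubeP (open_nbhs_nbhs (conj oU Uu)).
have inU (t : R) : `|t| < e -> U (t *: delta_mx 0 i + u).
  move=> te; apply: eU => j; rewrite !mxE addrK eqxx/=.
  by case: eqP => _; rewrite ?mulr1// mulr0 normr0.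
have ab (t : R) : t \in `](- e), e[%R -> `|t| < e by rewrite in_itv/= ltr_norml.
have D : is_derive (0 : R) 1 (fun t : R => f (t *: delta_mx 0 i + u)) 0.
  apply: (@derive1_at_max _ _ (- e) e); first by rewrite ge0_cp ?ltW.
  - move=> t /ab/inU Ut.
    by have /is_derive_line[] := Ck_on_derivable i fk Ut.
  - by rewrite in_itv/= oppr_lt0 e0.
  - by move=> t /ab/inU Ut; rewrite scale0r add0r; exact: fmax.
by have /is_derive_line := D; rewrite scale0r add0r => -[].
Qed.

(** A cube contains, with v, the path from u to v that changes the coordinates
    one after the other; the mean value theorem applies to each step. *)
Lemma constant_on_cube (f : 'rV[R]_n -> R) u e : Ck_on 1 (cube u e) f ->
  (forall v i, cube u e v -> partial i f v = 0) ->
  forall v, cube u e v -> f v = f u.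
Proof.
move=> fk f0 v uv.
pose w k : 'rV[R]_n := \row_j (if (j < k)%N then v 0 j else u 0 j).
suff H k : (k <= n)%N -> f (w k) = f u.
  by rewrite -(H n)//; congr f; apply/rowP => j; rewrite mxE ltn_ord.
elim: k => [_|k IH kn].
  by congr f; apply/rowP => j; rewrite mxE.
rewrite -IH ?(ltnW kn)//.
pose i := Ordinal kn; pose q : R := v 0 i - u 0 i.
have wE : w k.+1 = q *: delta_mx 0 i + w k.
  apply/rowP => j; rewrite !mxE eqxx/= ltnS leq_eqVlt.
  have [->/=|ji] := eqVneq j i; first by rewrite eqxx ltnn mulr1 subrK.
  by rewrite mulr0 add0r (_ : (j == k :> nat) = false)//; apply/negbTE.
have incube (t : R) : `|t| <= `|q| -> cube u e (t *: delta_mx 0 i + w k).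
  move=> tq j; rewrite !mxE eqxx/=.
  have [->/=|ji] := eqVneq j i.
    by rewrite ltnn mulr1 addrK; exact: le_lt_trans tq (uv i).
  rewrite mulr0 add0r; case: ifP => _; first exact: uv.
  by rewrite subrr normr0; exact: le_lt_trans (normr_ge0 _) (uv j).
pose g (t : R) := f (t *: delta_mx 0 i + w k).
have gD (t : R) : `|t| <= `|q| -> is_derive t 1 g 0.
  move=> /incube Ut; apply/is_derive_line; rewrite -(f0 _ i Ut).
  exact: Ck_on_derivable fk Ut.
have gC (a b : R) : (forall t, t \in `[a, b] -> `|t| <= `|q|) ->
    {within `[a, b], continuous g}.
  move=> H; apply: derivable_within_continuous => t tab.
  by have [] := gD t (H _ tab).
rewrite wE -/(g q); have -> : f (w k) = g 0 by rewrite /g scale0r add0r.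
have [q0|q0] := leP 0 q.
- have H t : t \in `[0, q] -> `|t| <= `|q|.
    by rewrite in_itv/= => /andP[t0 tq]; rewrite !ger0_norm.
  have [|c _] := @MVT_segment _ g (cst 0) 0 q q0 _ (gC _ _ H).
    by move=> t tq; apply: gD; apply: H; exact: subset_itv_oo_cc.
  by rewrite mul0r => /eqP; rewrite subr_eq0 => /eqP.
- have H t : t \in `[q, 0] -> `|t| <= `|q|.
    by rewrite in_itv/= => /andP[t0 tq]; rewrite !ler0_norm ?lerN2// ltW.
  have [|c _] := @MVT_segment _ g (cst 0) q 0 (ltW q0) _ (gC _ _ H).
    by move=> t tq; apply: gD; apply: H; exact: subset_itv_oo_cc.
  by rewrite mul0r => /eqP; rewrite subr_eq0 => /eqP.
Qed.

End directional_calculus.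

(** * Positive semidefinite matrices *)

Section positive_semidefinite.
Variables (R : realType) (n : nat) (a : 'M[R]_n).

Let sqn (w : 'rV[R]_n) : R := (w *m w^T) 0 0.

Let sqn_ge0 w : 0 <= sqn w.
Proof.
by rewrite /sqn mxE; apply: sumr_ge0 => i _; rewrite mxE -expr2 sqr_ge0.
Qed.

Let sqn_eq0 w : sqn w <= 0 -> w = 0.
Proof.
move=> w0; have /eqP : sqn w = 0 by apply/eqP; rewrite eq_le w0 sqn_ge0.
rewrite /sqn mxE psumr_eq0 => [/allP H|i _]; last first.
  by rewrite mxE -expr2 sqr_ge0.
apply/rowP => i; have := H i (mem_index_enum i).
by rewrite !mxE mulf_eq0 orbb => /eqP.
Qed.

Hypothesis aT : a^T = a.
Hypothesis a_psd : forall w : 'rV[R]_n, 0 <= (w *m a *m w^T) 0 0.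

(** Otherwise the form would be negative at w - t z, where z = w a, for a small
    t > 0. *)
Lemma psd_kernel (w : 'rV[R]_n) : (w *m a *m w^T) 0 0 = 0 -> w *m a = 0.
Proof.
move=> w0; apply: sqn_eq0; rewrite leNgt; apply/negP => A0.
set z := w *m a; pose B := (z *m a *m z^T) 0 0.
have B0 : 0 <= B by exact: a_psd.
pose t := sqn z / (B + 1).
have t0 : 0 < t by rewrite divr_gt0// ltr_wpDl.
have := a_psd (w - t *: z).
have -> : ((w - t *: z) *m a *m (w - t *: z)^T) 0 0 =
    t * (t * B - 2 * sqn z).
  have zw : (z *m a *m w^T) 0 0 = sqn z.
    by rewrite /sqn /z trmx_mul aT !mulmxA.
  have wz : (w *m a *m z^T) 0 0 = sqn z by [].
  have zz : (z *m a *m z^T) 0 0 = B by [].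
  have -> : (w - t *: z) *m a *m (w - t *: z)^T = w *m a *m w^T
      - t *: (w *m a *m z^T)
        - t *: (z *m a *m w^T) + (t * t) *: (z *m a *m z^T).
    have -> : (w - t *: z)^T = w^T - t *: z^T by apply/matrixP => i j;
      rewrite !mxE.
    rewrite !(mulmxBl, mulmxBr) -!(scalemxAl, scalemxAr).
    by rewrite scalerA opprB [X in _ + X]addrC addrA; congr (_ + _);
      rewrite addrAC.
  by move: w0 wz zw zz; rewrite !mxE => -> -> -> ->; ring.
rewrite pmulr_rge0// subr_ge0 => sB.
have tB : t * B <= sqn z.
  by rewrite /t mulrAC ler_pdivrMr ?ltr_wpDl// ler_wpM2l ?sqn_ge0// lerDl.
by move: A0 (le_trans sB tB); rewrite -/z; lra.
Qed.

(** The monic polynomial det (X + a) has no root in [0, +oo[, since a + x is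
    definite for x > 0 and a is invertible; hence it is positive at 0. *)
Lemma psd_unit_det_gt0 : a \in unitmx -> 0 < \det a.
Proof.
move=> au; set p := char_poly (- a).
have p0 : p.[0] = \det a.
  rewrite horner_coef0 char_poly_det -(scaleN1r a) detZ mulrA
    -exprMn mulrNN mulr1.
  by rewrite expr1n mul1r.
have noroot x : 0 <= x -> ~~ root p x.
  move=> x0; rewrite -eigenvalue_root_char;
    apply/negP => /eigenvalueP[w wa wn0].
  have E : (w *m a *m w^T) 0 0 = - (x * sqn w).
    by rewrite -[w *m a]opprK -mulmxN wa mulNmx -scalemxAl mxE [X in - X]mxE.
  have xw : x * sqn w = 0.
    apply/eqP; rewrite eq_le mulr_ge0 ?sqn_ge0// andbT -oppr_ge0 -E.
    exact: a_psd.
  have wa0 : w *m a = 0 by apply: psd_kernel; rewrite E xw oppr0.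
  by move: wn0; rewrite -(mulmxK au w) wa0 mul0mx eqxx.
have lp : 0 < lead_coef p by rewrite (monicP (char_poly_monic _)).
have [b pb] := polyrcf.poly_pinfty_gt_lc lp.
rewrite ltNge; apply/negP => d0.
have [x /itvP xb rx] : exists2 x, x \in `[0, Num.max 0 b] & root p x.
  apply: poly_ivt; first by rewrite le_max lexx.
  by rewrite p0 d0 (le_trans (ltW lp))// pb// le_max lexx orbT.
by have := noroot x; rewrite xb rx => /(_ isT).
Qed.

End positive_semidefinite.

(** * Iterated integrals over cubes *)

Section iterated_integral.
Variable R : realType.
Local Open Scope ereal_scope.

(** Monotonicity of the integral as a supremum, free of measurability: the
    partial integrals in an iterated integral of a density given only in charts
    are not known to be measurable. *)
Lemma ge0_le_integral_sup d (T : measurableType d)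
    (mu : {measure set T -> \bar R}) (f g : T -> \bar R) :
  (forall x, 0 <= f x) -> (forall x, f x <= g x) ->
  \int[mu]_x f x <= \int[mu]_x g x.
Proof.
move=> f0 fg; have g0 x : 0 <= g x by exact: le_trans (f0 x) (fg x).
rewrite !ge0_integralTE//; apply: le_ereal_sup => _ [h hf <-].
by exists h => // x; exact: le_trans (hf x) (fg x).
Qed.

Lemma integral_rV_ge0 n (f : 'rV[R]_n -> \bar R) :
  (forall v, 0 <= f v) -> 0 <= integral_rV f.
Proof.
elim: n f => [|n IH] f f0 /=; first exact: f0.
by apply: integral_ge0 => x _; exact: IH.
Qed.

Lemma le_integral_rV n (f g : 'rV[R]_n -> \bar R) :
  (forall v, 0 <= f v) -> (forall v, f v <= g v) ->
  integral_rV f <= integral_rV g.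
Proof.
elim: n f g => [|n IH] f g f0 fg /=; first exact: fg.
apply: ge0_le_integral_sup => x; first by apply: integral_rV_ge0.
exact: IH.
Qed.

Lemma integral_rV_cube n (u : 'rV[R]_n) (K e : R) : (0 <= K)%R -> (0 < e)%R ->
  integral_rV (fun v => (\1_(cube u e) v * K)%:E) = ((2 * e) ^+ n * K)%:E.
Proof.
elim: n u K => [|n IH] u K K0 e0 /=.
  by rewrite indicE mem_set ?mul1r ?expr0 ?mul1r// => -[].
pose u' : 'rV[R]_n := \row_j u ord0 (lift ord0 j).
pose I : set R := `](u ord0 ord0 - e)%R, (u ord0 ord0 + e)%R[%classic.
have E (x : R) (y : 'rV[R]_n) :
    \1_(cube u e) (row_mx (x%:M :
      'rV_1) y) = (\1_I x * \1_(cube u' e) y)%R :> R.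
  rewrite !indicE -natrM mulnb; congr (_%:R); congr nat_of_bool.
  have x0 : row_mx (x%:M : 'rV_1) y ord0 ord0 = x.
    by have := row_mxEl (x%:M : 'rV_1) y ord0 ord0; rewrite lshift0 => ->;
      rewrite mxE eqxx.
  have xj j : row_mx (x%:M : 'rV_1) y ord0 (lift ord0 j) = y ord0 j.
    by have := row_mxEr (x%:M : 'rV_1) y ord0 j; rewrite rshift1.
  apply/idP/andP => [/set_mem xy|[/set_mem /= xI /set_mem yu]].
    split; apply/mem_set.
      have := xy ord0; rewrite x0 /I/= in_itv/= ltr_norml => /andP[h1 h2].
      by apply/andP; split; lra.
    by move=> j; have := xy (lift ord0 j); rewrite xj mxE.
  apply/mem_set => j; case: (unliftP ord0 j) => [k|] ->.
    by rewrite xj; have := yu k; rewrite mxE.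
  move: xI; rewrite x0 /I/= in_itv/= ltr_norml => /andP[h1 h2].
  by apply/andP; split; lra.
transitivity (\int[@lebesgue_measure R]_x (((2 * e) ^+ n * K)%:E * (\1_I
  x)%:E)).
  apply: eq_integral => x _; rewrite -EFinM -mulrA.
  rewrite -(IH u' (K * \1_I x)%R) ?mulr_ge0//.
  by congr integral_rV; apply/funext => y; rewrite E; congr (_%:E); ring.
have mI : measurable I by rewrite /I; exact: measurable_itv.
rewrite ge0_integralZl//=.
- have -> : \int[@lebesgue_measure R]_x (\1_I x)%:E = lebesgue_measure I.
    by rewrite integral_indic// setIT.
  rewrite lebesgue_measure_itv/= lte_fin.
  have -> : (u ord0 ord0 - e < u ord0 ord0 + e)%R by lra.
  by rewrite -EFinB -EFinM; congr (_%:E); rewrite exprS; ring.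
- by apply/measurable_EFinP; exact: measurable_indic.
- by rewrite lee_fin mulr_ge0// exprn_ge0// mulr_ge0// ltW.
Qed.

End iterated_integral.

(** * Smooth functions and vector fields in charts *)

Section charts.
Variables (R : realType) (n : nat) (M : ptopologicalType) (c : chart R n M).

Lemma cinvK u : cimg c u -> cmap c (cinv c u) = u.
Proof. by move=> [x cx <-]; rewrite cmapK. Qed.

Lemma cdom_cinv u : cimg c u -> cdom c (cinv c u).
Proof. by move=> [x cx <-]; rewrite cmapK. Qed.

Lemma cimg_cmap x : cdom c x -> cimg c (cmap c x).
Proof. by exists x. Qed.

Lemma open_cmap_preimage (Q : set 'rV[R]_n) :
  open Q -> open (cdom c `&` cmap c @^-1` Q).
Proof.
move=> oQ; rewrite openE => x [cx Qx]; apply: filterI.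
  exact: open_nbhs_nbhs (conj (@cdom_open _ _ _ c) cx).
exact: (@cmap_continuous _ _ _ c _ cx) (open_nbhs_nbhs (conj oQ Qx)).
Qed.

Lemma open_cinv_preimage (O : set M) :
  open O -> open (cimg c `&` cinv c @^-1` O).
Proof.
move=> oO; rewrite openE => u [cu Ou]; apply: filterI.
  exact: open_nbhs_nbhs (conj (@cimg_open _ _ _ c) cu).
exact: (@cinv_continuous _ _ _ c _ cu) (open_nbhs_nbhs (conj oO Ou)).
Qed.

End charts.

Section smooth_functions.
Variables (R : realType) (n : nat) (M : ptopologicalType)
  (A : smooth_atlas R n M).
Local Notation C := (smooth_fun A).
Implicit Types (f g : C) (x : M) (c : chart R n M).

Lemma smooth_fun_add f g x : (f + g) x = f x + g x. Proof. by []. Qed.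
Lemma smooth_fun_opp f x : (- f) x = - f x. Proof. by []. Qed.
Lemma smooth_fun_mul f g x : (f * g) x = f x * g x. Proof. by []. Qed.
Lemma smooth_fun_scale (r : R) f x : (r *: f) x = r * f x. Proof. by []. Qed.
Lemma smooth_fun_zero x : (0 : C) x = 0. Proof. by []. Qed.
Lemma smooth_fun_one x : (1 : C) x = 1. Proof. by []. Qed.
Lemma smooth_fun_sum (I : Type) (r : seq I) (F : I -> C) x :
  (\sum_(i <- r) F i) x = \sum_(i <- r) F i x.
Proof. by elim/big_rec2: _ => // i y g _ <-. Qed.

Definition smooth_funE :=
  (smooth_fun_add, smooth_fun_opp, smooth_fun_mul, smooth_fun_scale,
   smooth_fun_zero, smooth_fun_one, smooth_fun_sum).

Lemma smooth_funP f g : (forall x, f x = g x) -> f = g.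
Proof. by move=> fg; apply/val_inj/funext. Qed.

Lemma smooth_fun_Ck f c k : charts A c -> Ck_on k (cimg c) (loc c f).
Proof. by move=> Ac; have /smoothpP/(_ c Ac) := valP f; exact. Qed.

Lemma smooth_fun_continuous f : continuous f.
Proof.
move=> x; have [c Ac cx] := charts_cover A x.
have nE : {near x, loc c f \o cmap c =1 f}.
  have nc : nbhs x (cdom c).
    by apply: open_nbhs_nbhs; split=> //; exact: cdom_open.
  by apply: filterS nc => y cy; rewrite /loc/= cmapK.
have fC : {for x, continuous (loc c f \o cmap c)}.
  apply: continuous_comp; first exact: (@cmap_continuous _ _ _ c).
  exact: Ck_on_continuous (smooth_fun_Ck f 0 Ac) (cimg_cmap cx).
rewrite /continuous_at -(nbhs_singleton nE).
by apply: cvg_trans fC; exact: (near_eq_cvg (F := nbhs x) nE).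
Qed.

Lemma is_derive_loc f c u i : charts A c -> cimg c u ->
  is_derive u (delta_mx 0 i) (loc c f) (partial i (loc c f) u).
Proof. by move=> Ac; apply: Ck_on_derivable (smooth_fun_Ck f 1 Ac). Qed.

Lemma partial_locM f g c u i : charts A c -> cimg c u ->
  partial i (loc c (f * g)) u =
    loc c f u * partial i (loc c g) u + loc c g u * partial i (loc c f) u.
Proof.
by move=> Ac cu; have [_ <-] := is_deriveM (is_derive_loc f i Ac cu)
  (is_derive_loc g i Ac cu).
Qed.

Lemma partial_locZD (r : R) f g c u i : charts A c -> cimg c u ->
  partial i (loc c (r *: f + g)) u =
    r * partial i (loc c f) u + partial i (loc c g) u.
Proof.
by move=> Ac cu; have [_ <-] := is_deriveD
  (is_deriveZ r (is_derive_loc f i Ac cu)) (is_derive_loc g i Ac cu).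
Qed.

Section vector_fields.
Variable V : C -> C.
Hypothesis Vv : vector_field V.

Lemma vector_fieldM f g : V (f * g) = f * V g + g * V f.
Proof.
apply: smooth_funP => x; have [c Ac cx] := charts_cover A x.
have [v [_ vE]] := Vv Ac; have cu := cimg_cmap cx.
have := cmapK cx; move: cu; move: (cmap c x) => u cu <-.
rewrite !smooth_funE !vE// !mulr_sumr -big_split/=; apply: eq_bigr => i _.
by rewrite partial_locM// /loc; ring.
Qed.

Lemma vector_field_linear (r : R) f g : V (r *: f + g) = r *: V f + V g.
Proof.
apply: smooth_funP => x; have [c Ac cx] := charts_cover A x.
have [v [_ vE]] := Vv Ac; have cu := cimg_cmap cx.
have := cmapK cx; move: cu; move: (cmap c x) => u cu <-.
rewrite !smooth_funE !vE// mulr_sumr -big_split/=; apply: eq_bigr => i _.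
by rewrite partial_locZD//; ring.
Qed.

(** All partial derivatives vanish at an interior maximum of the expression of
    f in a chart. *)
Lemma vector_field_at_max f x : (forall y, f y <= f x) -> V f x = 0.
Proof.
move=> fmax; have [c Ac cx] := charts_cover A x.
have [v [_ vE]] := Vv Ac; have cu := cimg_cmap cx.
rewrite -(cmapK cx) vE//; apply: big1 => i _.
rewrite (partial_at_max (U := cimg c)) ?mulr0//;
  first exact: (@cimg_open _ _ _ c).
  exact: smooth_fun_Ck.
by move=> v' _; rewrite /loc cmapK.
Qed.

End vector_fields.
End smooth_functions.

(** * Smooth functions with a prescribed differential *)

Section localized_functions.
Variables (R : realType) (n : nat).

Implicit Types (r : R) (y : 'I_n -> R) (U : set 'rV[R]_n).

(** A function of the coordinates y j rather than of a vector: it can then be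
    composed with the coordinates of one chart read in another. *)
Definition box_bump (u0 : 'rV[R]_n) (r : R) (y : 'I_n -> R) : R :=
  \prod_j (flat 1 (r - (y j - u0 0 j)) * flat 1 (r + (y j - u0 0 j))).

Lemma box_bump_center (u0 : 'rV[R]_n) r : 0 < r ->
  box_bump u0 r (fun j => u0 0 j) != 0.
Proof.
move=> r0; apply/prodf_neq0 => j _; rewrite subrr subr0 addr0 mulf_neq0// /flat.
all: by rewrite r0 hornerC mul1r gt_eqF// expR_gt0.
Qed.

Lemma box_bump_out (u0 : 'rV[R]_n) r y j : r < `|y j - u0 0 j| ->
  box_bump u0 r y = 0.
Proof.
move=> ry; apply/eqP/prodf_eq0; exists j => //; rewrite mulf_eq0.
have [y0|y0] := leP 0 (y j - u0 0 j).
  by rewrite flat_eq0 ?eqxx// subr_le0 ltW// -(ger0_norm y0).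
have h : r + (y j - u0 0 j) <= 0 by move: ry; rewrite ltr0_norm// => ?; lra.
by rewrite (flat_eq0 1 h) eqxx orbT.
Qed.

Lemma Ck_on_box_bump k U (u0 : 'rV[R]_n) r (phi : 'I_n -> 'rV[R]_n -> R) :
  open U ->
  (forall j, Ck_on k U (phi j)) ->
  Ck_on k U (fun u => box_bump u0 r (fun j => phi j u)).
Proof.
move=> oU phik; apply: Ck_on_prod => // j.
have yk : Ck_on k U (fun u => phi j u - u0 0 j).
  exact: (Ck_onD oU (phik j) (Ck_on_cst oU k (- u0 0 j))).
have nyk : Ck_on k U (fun u => r - (phi j u - u0 0 j)).
  apply: eq_Ck_on (Ck_onD oU (Ck_on_cst oU k r)
    (Ck_onM oU (Ck_on_cst oU k (-1)) yk)) => // u _.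
  by rewrite -[LHS]/(r + (-1) * (phi j u - u0 0 j)) mulN1r.
apply: (Ck_onM oU (Ck_on_flat 1 oU nyk)).
exact: (Ck_on_flat 1 oU (Ck_onD oU (Ck_on_cst oU k r) yk)).
Qed.

(** The linear form w at u0, cut off outside the box of radius r and normalized
    so that its differential at u0 is w. *)
Definition box_linear (u0 w : 'rV[R]_n) (r : R) (y : 'I_n -> R) : R :=
  (box_bump u0 r (fun j => u0 0 j))^-1 * box_bump u0 r y *
  (\sum_i w 0 i * (y i - u0 0 i)).

Lemma Ck_on_box_linear k U (u0 w : 'rV[R]_n) r
    (phi : 'I_n -> 'rV[R]_n -> R) :
  open U ->
  (forall j, Ck_on k U (phi j)) ->
  Ck_on k U (fun u => box_linear u0 w r (fun j => phi j u)).
Proof.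
move=> oU phik; apply: (Ck_onM oU); last first.
  apply: Ck_on_sum => // i; apply: (Ck_onM oU (Ck_on_cst oU k (w 0 i))).
  exact: (Ck_onD oU (phik i) (Ck_on_cst oU k (- u0 0 i))).
exact: (Ck_onM oU (Ck_on_cst oU k _) (Ck_on_box_bump u0 r oU phik)).
Qed.

Lemma is_derive_box_linear (u0 w : 'rV[R]_n) r i : 0 < r ->
  is_derive u0 (delta_mx 0 i) (fun u => box_linear u0 w r (fun j => u 0 j))
    (w 0 i).
Proof.
move=> r0.
have coordk j : Ck_on 1 [set: 'rV[R]_n] (fun u => u 0 j).
  by apply: Ck_on_coord; exact: openT.
pose b (u : 'rV[R]_n) :=
  (box_bump u0 r (fun j => u0 0 j))^-1 * box_bump u0 r (fun j => u 0 j).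
have Db : is_derive u0 (delta_mx 0 i) b (partial i b u0).
  apply: (@Ck_on_derivable _ _ 0 setT) => //.
  apply: (Ck_onM openT (Ck_on_cst openT 1 _)).
  exact: Ck_on_box_bump openT coordk.
have Dl : is_derive u0 (delta_mx 0 i)
    (fun u : 'rV[R]_n => \sum_j w 0 j * (u 0 j - u0 0 j)) (w 0 i).
  have u00 : (0 : R) *: delta_mx 0 i + u0 = u0 by rewrite scale0r add0r.
  rewrite -{1}u00; apply/is_derive_line.
  have -> : (fun t : R => \sum_j w 0 j *
      ((t *: delta_mx 0 i + u0) 0 j - u0 0 j)) = (fun t : R => w 0 i * t).
    apply/funext => t; rewrite (bigD1 i)//= big1 => [|j ji].
      by rewrite !mxE !eqxx addrK mulr1 addr0.
    by rewrite !mxE eqxx (negbTE ji) addrK !mulr0.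
  by apply: is_derive_eq; rewrite /GRing.scale/= mulr1.
have D := is_deriveM Db Dl; apply: (is_derive_eq D).
rewrite /GRing.scale/= /b mulVf ?box_bump_center// mul1r.
by rewrite big1 ?mul0r ?addr0// => j _; rewrite subrr mulr0.
Qed.

Variables (M : ptopologicalType) (A : smooth_atlas R n M).

(** The cut-off linear form of a chart, extended by 0.  It is smooth because its
    support is compact, hence closed in M by separation, so every point of M has
    a neighbourhood either in the chart or off the support. *)
Lemma smooth_fun_with_differential (c : chart R n M) (x : M) (w : 'rV[R]_n) :
  hausdorff_space M -> charts A c -> cdom c x ->
  exists f : smooth_fun A, f x = 0 /\
    forall i, partial i (loc c f) (cmap c x) = w 0 i.
Proof.
move=> hM Ac cx; set u0 := cmap c x.
have cu0 : cimg c u0 by exact: cimg_cmap.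
have [e e0 eU] := cubeP (open_nbhs_nbhs (conj (@cimg_open _ _ _ c) cu0)).
pose r := e / 2; have r0 : 0 < r by rewrite divr_gt0.
have re : r < e by rewrite /r; lra.
pose Q : set 'rV[R]_n :=
  [set v | forall j, `[u0 0 j - r, u0 0 j + r]%classic (v 0 j)].
have QU : Q `<=` cimg c.
  move=> v Qv; apply: eU => j; have := Qv j;
    rewrite /= in_itv/= => /andP[h1 h2].
  by apply: le_lt_trans re; rewrite ler_norml; apply/andP; split; lra.
have clK : closed (cinv c @` Q).
  apply: compact_closed => //; apply: continuous_compact.
    apply: continuous_in_subspaceT => v /set_mem /QU cv.
    exact: (@cinv_continuous _ _ _ c).
  apply: (@rV_compact R n (fun j => `[u0 0 j - r, u0 0 j + r]%classic)) => j.
  exact: segment_compact.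
pose F (y : M) : R :=
  if `[< cdom c y >] then box_linear u0 w r (fun j => cmap c y 0 j) else 0.
have Fdom (y : M) : cdom c y -> F y = box_linear u0 w r (fun j => cmap c y 0 j).
  by move=> cy; rewrite /F asboolT.
have Fout (y : M) : ~ (cinv c @` Q) y -> F y = 0.
  move=> Ky; rewrite /F; case: asboolP => // cy; rewrite /box_linear.
  suff [j ry] : exists j, r < `|cmap c y 0 j - u0 0 j|.
    by rewrite (box_bump_out ry) mulr0 mul0r.
  apply: contrapT => H; apply: Ky; exists (cmap c y); last by rewrite cmapK.
  move=> j; rewrite /= in_itv/=; have : `|cmap c y 0 j - u0 0 j| <= r.
    by rewrite leNgt; apply/negP => ry; apply: H; exists j.
  by rewrite ler_norml => /andP[h1 h2]; apply/andP; split; lra.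
have Fs : F \in smoothp A.
  apply/smoothpP => c' Ac' k; apply: Ck_on_local => u cu.
  have [cy|ncy] := pselect (cdom c (cinv c' u)).
  - exists (cimg c' `&` cinv c' @^-1` cdom c); split=> //.
    have oW := open_cinv_preimage (c := c') (@cdom_open _ _ _ c).
    apply: (eq_Ck_on oW (f := fun v =>
      box_linear u0 w r (fun j => cmap c (cinv c' v) 0 j))).
      by move=> v [_ cv]; rewrite /loc Fdom.
    apply: Ck_on_box_linear => // j.
    have -> : cimg c' `&` cinv c' @^-1` cdom c =
      cmap c' @` (cdom c' `&` cdom c).
      apply/seteqP; split=> [v [cv cv']|v [y [cy' cy''] <-]].
        by exists (cinv c' v); [split=> //; exact: cdom_cinv|exact: cinvK].
      by split; [exact: cimg_cmap|rewrite /= cmapK].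
    exact: (charts_compat Ac' Ac j k).
  - exists (cimg c' `&` cinv c' @^-1` (~` (cinv c @` Q))); split.
      split=> // -[v Qv vE]; apply: ncy; rewrite -vE; apply: cdom_cinv;
        exact: QU.
    have oW := open_cinv_preimage (c := c') (closed_openC clK).
    by apply: (eq_Ck_on oW _ (Ck_on_cst oW k 0)) => v [_ /Fout].
exists (SmoothFun Fs); split.
  rewrite /= Fdom// /box_linear big1 ?mulr0// => i _.
  by rewrite subrr mulr0.
move=> i; have [_ <-] := is_derive_box_linear u0 w i r0.
apply: near_eq_derive;
  apply: filterS (open_nbhs_nbhs (conj (@cimg_open _ _ _ c) cu0)) => v cv.
by rewrite /loc/= Fdom; [rewrite cinvK|exact: cdom_cinv].
Qed.

End localized_functions.

(** * The carre du champ and the symbol of the generator *)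

Section carre_du_champ.
Variables (R : realType) (n : nat) (M : ptopologicalType)
  (A : smooth_atlas R n M) (l : nat).
Local Notation C := (smooth_fun A).
Variables (V0 : C -> C) (V : 'I_l -> C -> C).
Hypotheses (V0v : vector_field V0) (Vv : forall a, vector_field (V a)).
Implicit Types (f g k : C) (x : M).

Let L := generator V0 V.

Definition carre_du_champ f g : C := \sum_a V a f * V a g.

Lemma carre_du_champE f g x :
  carre_du_champ f g x = \sum_a V a f x * V a g x.
Proof. by rewrite /carre_du_champ smooth_fun_sum. Qed.

Lemma carre_du_champM f g k :
  carre_du_champ f (g * k) = g * carre_du_champ f k + k * carre_du_champ f g.
Proof.
apply: smooth_funP => x;
  rewrite smooth_fun_add !smooth_fun_mul !carre_du_champE.
rewrite !mulr_sumr -big_split/=; apply: eq_bigr => a _.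
by rewrite (vector_fieldM (Vv a)) !smooth_funE; ring.
Qed.

Lemma carre_du_champ_linear f (r : R) g k :
  carre_du_champ f (r *: g + k) = r *: carre_du_champ f g + carre_du_champ f k.
Proof.
apply: smooth_funP => x;
  rewrite smooth_fun_add smooth_fun_scale !carre_du_champE.
rewrite mulr_sumr -big_split/=; apply: eq_bigr => a _.
by rewrite (vector_field_linear (Vv a)) !smooth_funE; ring.
Qed.

Lemma carre_du_champ_at_max f g x :
  (forall y, g y <= g x) -> carre_du_champ f g x = 0.
Proof.
move=> gmax; rewrite carre_du_champE; apply: big1 => a _.
by rewrite (vector_field_at_max (Vv a) gmax) mulr0.
Qed.

Lemma carre_du_champ_ge0 f x : 0 <= carre_du_champ f f x.
Proof.
by rewrite carre_du_champE; apply: sumr_ge0 => a _; rewrite -expr2 sqr_ge0.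
Qed.

Lemma carre_du_champ_eq0 f x : carre_du_champ f f x = 0 ->
  forall a, V a f x = 0.
Proof.
move=> /eqP; rewrite carre_du_champE psumr_eq0 => [/allP H a|a _].
  by have := H a (mem_index_enum a); rewrite mulf_eq0 orbb => /eqP.
by rewrite -expr2 sqr_ge0.
Qed.

Lemma generatorM f g : L (f * g) = f * L g + g * L f + carre_du_champ f g.
Proof.
have LE k x : L k x = 2^-1 * (\sum_a V a (V a k) x) + V0 k x.
  by rewrite /L /generator smooth_fun_add smooth_fun_scale smooth_fun_sum.
apply: smooth_funP => x;
  rewrite LE !smooth_fun_add !smooth_fun_mul !LE carre_du_champE.
rewrite (vector_fieldM V0v).
have -> : \sum_a V a (V a (f * g)) x = f x * (\sum_a V a (V a g) x) +
    g x * (\sum_a V a (V a f) x) + 2 * (\sum_a V a f x * V a g x).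
  rewrite !mulr_sumr -!big_split/=; apply: eq_bigr => a _.
  rewrite (vector_fieldM (Vv a)) -[X in V a (X + _)]scale1r.
  by rewrite (vector_field_linear (Vv a)) !(vector_fieldM (Vv a)) !smooth_funE;
    ring.
by rewrite !smooth_funE; field.
Qed.

(** The left-hand side is the double commutator of L with multiplications by f
    and g, applied to k.  By generatorM the commutator with f sends k to
    k (L f) + Gamma f k; the first term commutes with g, and the derivation
    Gamma f contributes (Gamma f g) k. *)
Lemma generator_double_commutator f g k :
  L (f * (g * k)) - f * L (g * k) - g * L (f * k) + f * (g * L k) =
  carre_du_champ f g * k.
Proof.
apply: smooth_funP => x; rewrite (generatorM f (g * k)) (generatorM f k).
by rewrite carre_du_champM !smooth_funE; ring.
Qed.

Section principal_symbol.
Variables (c : chart R n M) (a : 'rV[R]_n -> 'M[R]_n).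
Hypotheses (hM : hausdorff_space M) (Ac : charts A c).
Hypothesis La : second_order_part L c a.

Definition differential f x : 'rV[R]_n :=
  \row_i partial i (loc c f) (cmap c x).

(** At a zero of f, both f^2 and its first derivatives vanish, so only the
    second-order part of L contributes. *)
Lemma second_order_part_sqr f x : cdom c x -> f x = 0 ->
  L (f * f) x = (differential f x *m a (cmap c x) *m (differential f x)^T) 0 0.
Proof.
move=> cx fx; have [_ [_ [b [e [_ [_ LE]]]]]] := La.
have cu := cimg_cmap cx; set u := cmap c x in cu *.
have fu : loc c f u = 0 by rewrite /loc /u cmapK.
have xE : x = cinv c u by rewrite /u cmapK.
have D2 i j : partial i (partial j (loc c (f * f))) u =
    2 * (partial i (loc c f) u * partial j (loc c f) u).
  have nE : {near u, (loc c f * partial j (loc c f)) +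
      (loc c f * partial j (loc c f)) =1 partial j (loc c (f * f))}.
    apply: filterS (open_nbhs_nbhs (conj (@cimg_open _ _ _ c) cu)) => v cv.
    by rewrite partial_locM.
  have Dj : is_derive u (delta_mx 0 i) (partial j (loc c f))
      (partial i (partial j (loc c f)) u).
    have [_ /(_ j)[_ fj]] := smooth_fun_Ck f 2 Ac.
    exact: (@Ck_on_derivable _ _ 0 (cimg c) _ _ _ fj cu).
  have Dm := is_deriveM (is_derive_loc f i Ac cu) Dj.
  have [_ E] := near_eq_is_derive nE (is_deriveD Dm Dm).
  by rewrite {1}/partial E fu scale0r add0r /GRing.scale/=; ring.
rewrite {1}xE LE// [X in _ + X + _]big1 => [|i _]; last first.
  by rewrite partial_locM// fu !mul0r addr0 mulr0.
rewrite [X in _ + X](_ : _ = 0) ?addr0; last first.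
  by rewrite -[loc c (f * f) u]/(loc c f u * loc c f u) fu !mulr0.
rewrite exchange_big mulr_sumr mxE; apply: eq_bigr => j _.
rewrite !mxE mulr_suml mulr_sumr; apply: eq_bigr => i _.
by rewrite D2 !mxE -/u; field.
Qed.

(** Both sides depend only on the differential of f at x, so f may be replaced
    by a function g with the same differential and g x = 0; then both sides are
    L (g^2) x. *)
Lemma symbol_sum_of_squares f x : cdom c x ->
  (differential f x *m a (cmap c x) *m (differential f x)^T) 0 0 =
  \sum_i (V i f x) ^+ 2.
Proof.
move=> cx; have [g [gx dg]] :=
  smooth_fun_with_differential (differential f x) hM Ac cx.
have dE : differential f x = differential g x.
  by apply/rowP => i; rewrite [RHS]mxE dg.
have Vg i : V i f x = V i g x.
  have [v [_ vE]] := Vv i Ac; have cu := cimg_cmap cx.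
  rewrite -(cmapK cx) !vE//; apply: eq_bigr => j _; congr (_ * _).
  by have /rowP/(_ j) := dE; rewrite !mxE.
rewrite dE -second_order_part_sqr//
  generatorM !smooth_fun_add !smooth_fun_mul gx !mul0r !add0r.
by rewrite carre_du_champE; apply: eq_bigr => i _; rewrite Vg expr2.
Qed.

Lemma symbol_psd x (w : 'rV[R]_n) : cdom c x ->
  0 <= (w *m a (cmap c x) *m w^T) 0 0.
Proof.
move=> cx; have [g [gx dg]] := smooth_fun_with_differential w hM Ac cx.
have -> : w = differential g x by apply/rowP => i; rewrite mxE dg.
by rewrite symbol_sum_of_squares//; apply: sumr_ge0 => i _; exact: sqr_ge0.
Qed.

Lemma symbol_det_gt0 u : cimg c u -> a u \in unitmx -> 0 < \det (a u).
Proof.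
move=> cu au; have [_ [aT _]] := La.
apply: psd_unit_det_gt0 => //; first exact: aT.
by move=> w; rewrite -(cinvK cu); apply: symbol_psd; exact: cdom_cinv.
Qed.

Lemma differential_eq0 f x : cdom c x -> a (cmap c x) \in unitmx ->
  carre_du_champ f f x = 0 -> differential f x = 0.
Proof.
move=> cx au /carre_du_champ_eq0 Vf; have [_ [aT _]] := La.
have ker := psd_kernel (aT _ (cimg_cmap cx)) (fun w => symbol_psd w cx).
rewrite -(mulmxK au (differential f x)) ker ?mul0mx//.
by rewrite symbol_sum_of_squares// big1// => i _; rewrite Vf expr0n.
Qed.

End principal_symbol.
End carre_du_champ.

(** * Local bounds on the Riemannian measure *)

Section riemannian_volume.
Variables (R : realType) (n : nat) (M : ptopologicalType)
  (A : smooth_atlas R n M) (l : nat).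
Local Notation C := (smooth_fun A).
Variables (V0 : C -> C) (V : 'I_l -> C -> C).
Hypotheses (V0v : vector_field V0) (Vv : forall a, vector_field (V a)).
Variables (g : chart R n M -> 'rV[R]_n -> 'M[R]_n)
  (omega : {measure set (borel M) -> \bar R}).
Hypotheses (hM : hausdorff_space M) (cM : compact [set: M]).
Hypotheses (gL : attached_metric (generator V0 V) g)
  (og : riemannian_measure A g omega).

Lemma open_borel (O : set M) : open O -> measurable (O : set (borel M)).
Proof. exact: sub_sigma_algebra. Qed.

Lemma continuous_det (a : 'rV[R]_n -> 'M[R]_n) (U : set 'rV[R]_n) u :
  open U -> U u -> (forall i j, smooth_on U (fun v => a v i j)) ->
  {for u, continuous (fun v => \det (a v))}.
Proof.
move=> oU Uu asm; apply: (@Ck_on_continuous _ _ 0 U) => //.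
apply: (Ck_on_sum _ oU) => s; apply: (Ck_onM oU (Ck_on_cst oU 0 _)).
by apply: (Ck_on_prod _ oU) => i; exact: asm.
Qed.

(** On a small cube around x in a chart, the determinant of the symbol stays
    between half and twice its positive value at x, which bounds the density of
    omega by constants on both sides. *)
Lemma riemannian_measure_local x (O : set M) : open O -> O x ->
  exists B : set M, [/\ open B, B x, B `<=` O &
    (0 < omega (B : set (borel M)) < +oo)%E].
Proof.
move=> oO Ox; have [c Ac cx] := charts_cover A x.
have [a [La ag]] := gL Ac; have [asm _] := La.
set u0 := cmap c x; have cu0 : cimg c u0 by exact: cimg_cmap.
have ocimg := @cimg_open _ _ _ c.
have det_gt0 u : cimg c u -> 0 < \det (a u).
  by move=> cu; apply: (symbol_det_gt0 V0v Vv hM Ac La cu); have [] := ag u cu.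
pose d0 := \det (a u0); have d00 : 0 < d0 by exact: det_gt0.
have dC := continuous_det ocimg cu0 asm.
have : \forall v \near u0, [/\ cimg c v, O (cinv c v) &
  d0 / 2 < \det (a v) < 2 * d0].
  have nb : nbhs u0 (cimg c `&` cinv c @^-1` O).
    apply: open_nbhs_nbhs; split; first exact: open_cinv_preimage.
    by split=> //; rewrite /= /u0 cmapK.
  have lo : d0 / 2 < d0 by rewrite ltr_pdivrMr// ltr_pMr// ltr1n.
  have up : d0 < 2 * d0 by rewrite ltr_pMl// ltr1n.
  near=> v; have [cv Ov] : (cimg c `&` cinv c @^-1` O) v by near: v.
  by split=> //; apply/andP; split; near: v;
    [exact: (cvgr_gt _ dC)|exact: (cvgr_lt _ dC)].
move=> /cubeP[e e0 eP].
pose B := cdom c `&` cmap c @^-1` cube u0 e.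
have oB : open B by apply: open_cmap_preimage; exact: cube_open.
have BE : cmap c @` B = cube u0 e.
  apply/seteqP; split=> [v [y [_ yv] <-]//|v uv].
  have [cv _ _] := eP v uv; exists (cinv c v); last exact: cinvK.
  by split; [exact: cdom_cinv|rewrite /= cinvK].
exists B; split=> //.
- by split=> //; exact: cube_center.
- by move=> y [cy /eP[_ Oy _]]; rewrite -(cmapK cy).
have mB : measurable (B : set (borel M)) by exact: open_borel.
have oBE := og Ac mB (fun y yB => yB.1).
have gbound v : cube u0 e v ->
    Num.sqrt ((2 * d0)^-1) <= Num.sqrt (\det (g c v)) <= Num.sqrt ((d0 / 2)^-1).
  move=> /eP[cv _ /andP[lo up]]; have [_ ->] := ag v cv.
  have dv := det_gt0 v cv.
  rewrite det_inv !ler_wsqrtr// lef_pV2 ?posrE ?ltW//.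
  - by rewrite divr_gt0.
  - by rewrite mulr_gt0.
pose K1 := Num.sqrt ((2 * d0)^-1); pose K2 := Num.sqrt ((d0 / 2)^-1).
have K10 : 0 < K1 by rewrite sqrtr_gt0 invr_gt0 mulr_gt0.
have K20 : 0 <= K2 by exact: sqrtr_ge0.
have lo : (((2 * e) ^+ n * K1)%:E <= omega (B : set (borel M)))%E.
  rewrite oBE BE -(integral_rV_cube u0 (ltW K10) e0);
    apply: le_integral_rV => v.
    by rewrite lee_fin mulr_ge0// ltW.
  rewrite lee_fin indicE; have [/set_mem/gbound/andP[h _]|_] := boolP (v \in _).
    by rewrite !mul1r.
  by rewrite !mul0r.
have up : (omega (B : set (borel M)) <= ((2 * e) ^+ n * K2)%:E)%E.
  rewrite oBE BE -(integral_rV_cube u0 K20 e0); apply: le_integral_rV => v.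
    by rewrite lee_fin mulr_ge0// sqrtr_ge0.
  rewrite lee_fin indicE; have [/set_mem/gbound/andP[_ h]|_] := boolP (v \in _).
    by rewrite !mul1r.
  by rewrite !mul0r.
apply/andP; split; last exact: le_lt_trans up (ltry _).
by apply: lt_le_trans lo; rewrite lte_fin mulr_gt0// exprn_gt0// mulr_gt0.
Unshelve. all: by end_near. Qed.

Lemma riemannian_measure_open_gt0 x (O : set M) : open O -> O x ->
  (0 < omega (O : set (borel M)))%E.
Proof.
move=> oO Ox; have [B [oB Bx BO /andP[B0 _]]] := riemannian_measure_local oO Ox.
by apply: lt_le_trans B0 _; apply: le_measure => //; rewrite inE;
  exact: open_borel.
Qed.

Lemma riemannian_measure_finite : (omega [set: borel M] < +oo)%E.
Proof.
have /choice[B BP] : forall x : M, exists B : set M, [/\ open B, B x &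
    (omega (B : set (borel M)) < +oo)%E].
  move=> x; have [B [oB Bx _ /andP[_ Bf]]] :=
    riemannian_measure_local openT (I : setT x).
  by exists B.
move: cM; rewrite compact_cover => /(_ M setT B).
case=> [x _|x _|D _ DM]; first by have [] := BP x.
  by exists x => //; have [] := BP x.
have mT : measurable [set: borel M] by exact: measurableT.
apply: le_lt_trans (content_sub_fsum omega (finite_fset D) _ mT DM) _.
  by move=> x _; apply: open_borel; have [] := BP x.
rewrite fsbig_finite//=; apply: lte_sum_pinfty => x _.
by have [] := BP x.
Qed.

End riemannian_volume.

(** * The adjoint of the generator *)

Section adjoint.
Variables (R : realType) (n : nat) (M : ptopologicalType)
  (A : smooth_atlas R n M).
Local Notation C := (smooth_fun A).
Variable omega : {measure set (borel M) -> \bar R}.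
Hypotheses (cM : compact [set: M])
  (omega_fin : (omega [set: borel M] < +oo)%E)
  (omega_pos : forall (O : set M) x, open O -> O x ->
    (0 < omega (O : set (borel M)))%E).
Implicit Types f g k : C.

Lemma smooth_fun_argmax f : exists x, forall y, f y <= f x.
Proof.
have [||x _ H] := @compact_EVT_max M R f setT _ cM; first by exists point.
  by apply: continuous_subspaceT; exact: smooth_fun_continuous.
by exists x => y; apply: H; rewrite inE.
Qed.

Lemma smooth_fun_bounded f : exists K, forall x, `|f x| <= K.
Proof.
have [x xP] := smooth_fun_argmax f; have [y yP] := smooth_fun_argmax (- f).
exists (Num.max (f x) (- f y)) => z; rewrite ler_norml; apply/andP; split.
  by rewrite lerNl le_max (yP z) orbT.
by rewrite le_max xP.
Qed.

Lemma smooth_fun_integrable f :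
  omega.-integrable [set: borel M] (EFin \o (f : borel M -> R)).
Proof.
apply: measurable_bounded_integrable => //.
- apply: (measurability _ (RGenOpens.measurableE R)) => _ [_ [a [b ->] <-]].
  rewrite setTI; apply: open_borel.
  by apply: open_comp => // x _; exact: smooth_fun_continuous.
- have [K KP] := smooth_fun_bounded f; exists K; split; rewrite ?num_real//.
  by move=> r Kr x _; apply: le_trans (KP x) (ltW Kr).
Qed.

Definition smooth_integral f : R := (\int[omega]_x f x)%R.

Lemma smooth_integral_linear (r : R) f g :
  smooth_integral (r *: f + g) = r * smooth_integral f + smooth_integral g.
Proof.
rewrite /smooth_integral -RintegralZl//; last exact: smooth_fun_integrable.
rewrite -RintegralD//; last exact: smooth_fun_integrable.
exact: (smooth_fun_integrable (r *: f)).
Qed.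

(** If f x is not 0, then f^2 exceeds a positive constant on a neighbourhood of
    x, which has positive measure. *)
Lemma smooth_integral_sqr_eq0 f : smooth_integral (f * f) = 0 -> f = 0.
Proof.
move=> If; apply: smooth_funP => x; apply: contrapT => /eqP fx.
pose e := (f x * f x) / 2.
have fx0 : 0 < f x * f x by rewrite -expr2 exprn_even_gt0.
have e0 : 0 < e by rewrite divr_gt0.
pose O : set M := (f * f) @^-1` `]e, +oo[%classic.
have oO : open O.
  by apply: open_comp => // y _; exact: smooth_fun_continuous.
have Ox : O x by rewrite /O/= in_itv/= andbT /e ltr_pdivrMr// ltr_pMr// ltr1n.
have mO : measurable (O : set (borel M)) by exact: open_borel.
have I0 : (\int[omega]_y ((f * f : C) y)%:E = 0)%E.
  have fin := integrable_fin_num measurableT (smooth_fun_integrable (f * f)).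
  by rewrite -[LHS]fineK//; congr (_%:E).
have : (\int[omega]_y (e%:E * (\1_O y)%:E) <=
    \int[omega]_y ((f * f : C) y)%:E)%E.
  apply: ge0_le_integral_sup => y.
    by rewrite -EFinM lee_fin mulr_ge0// ltW.
  rewrite -EFinM lee_fin indicE; have [/set_mem|_] := boolP (y \in O).
    by rewrite /O/= in_itv/= andbT mulr1 => /ltW.
  by rewrite mulr0 smooth_fun_mul -expr2 sqr_ge0.
rewrite I0 ge0_integralZl//=; last 2 first.
- by apply/measurable_EFinP; exact: measurable_indic.
- by rewrite lee_fin ltW.
rewrite integral_indic// setIT leNgt => /negP; apply.
by rewrite mule_gt0 ?lte_fin//; exact: omega_pos oO Ox.
Qed.

Variables (l : nat) (V0 : C -> C) (V : 'I_l -> C -> C) (Lstar : C -> C).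
Hypotheses (V0v : vector_field V0) (Vv : forall a, vector_field (V a)).
Hypothesis LstarP : adjoint_operator omega (generator V0 V) Lstar.

(** Multiplications are symmetric, so the double commutator of the adjoint pairs
    with functions as the double commutator of L, which is multiplication by
    Gamma f g.  The difference u of the two sides is paired with u itself. *)
Lemma adjoint_double_commutator f g k :
  Lstar (f * (g * k)) - f * Lstar (g * k) - g * Lstar (f * k) +
    f * (g * Lstar k) = carre_du_champ V f g * k.
Proof.
apply/eqP; rewrite -subr_eq0; apply/eqP; set u := (X in X = 0).
apply: smooth_integral_sqr_eq0.
have adj p q : smooth_integral (p * Lstar q) =
    smooth_integral (generator V0 V p * q) by rewrite /smooth_integral LstarP.
have := generator_double_commutator V0v Vv f g u.
move: (generator V0 V) (carre_du_champ V f g) @u adj => L G u adj LG.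
have intD p q : smooth_integral (p + q) = smooth_integral p + smooth_integral q.
  by rewrite -[p in LHS]scale1r smooth_integral_linear mul1r.
have intB p q : smooth_integral (p - q) = smooth_integral p - smooth_integral q.
  by rewrite addrC -scaleN1r smooth_integral_linear mulN1r addrC.
(* Only one factor u is expanded: the pairing moves Lstar onto the other. *)
have -> : u * u = u * Lstar (f * (g * k)) - (f * u) * Lstar (g * k)
    - (g * u) * Lstar (f * k) + (f * (g * u)) * Lstar k - u * (G * k).
  apply: smooth_funP => x; rewrite smooth_fun_mul.
  have -> : u x = Lstar (f * (g * k)) x - f x * Lstar (g * k) x
      - g x * Lstar (f * k) x + f x * (g x * Lstar k x) - G x * k x by [].
  by rewrite !(smooth_fun_add, smooth_fun_opp, smooth_fun_mul); ring.
rewrite intB intD intB intB !adj -intB -intB -intD -intB.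
rewrite [X in smooth_integral X](_ : _ = 0).
  by rewrite -[0](subrr 0) intB subrr.
clearbody u; apply: smooth_funP => x.
move/(congr1 (fun p : C => p x * k x)): LG; rewrite !smooth_funE => LG.
by lra.
Qed.

End adjoint.

(** * Maximum principle and linear dependence *)

Section linear_dependence.
Variables (K : fieldType) (E : lmodType K).

Lemma span_dependent k (e : 'I_k -> E) (v : 'I_k.+1 -> E) :
  (forall j, exists r : 'I_k -> K, v j = \sum_i r i *: e i) ->
  exists2 c : 'rV[K]_k.+1, c != 0 & \sum_j c 0 j *: v j = 0.
Proof.
move=> /choice[r vE]; pose B : 'M[K]_(k.+1, k) := \matrix_(j, i) r j i.
have : kermx B != 0.
  rewrite kermx_eq0 /row_free; apply/negP => /eqP rB.
  by have := rank_leq_col B; rewrite rB ltnn.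
move=> /rowV0Pn[c /sub_kermxP cB cn0]; exists c => //.
under eq_bigr => j _ do rewrite vE scaler_sumr.
rewrite exchange_big big1// => i _.
under eq_bigr => j _ do rewrite scalerA.
rewrite -scaler_suml; have := congr1 (fun w : 'rV_k => w 0 i) cB.
by rewrite !mxE; under eq_bigr => j _ do rewrite mxE; move=> ->;
  rewrite scale0r.
Qed.

(** If a is the first nonzero coefficient, at index j, the relation reads
    X^(j+1) (a phi + X T) = 0 with T a combination of iterates of phi, and
    X^(j+1) may be replaced by X. *)
Lemma image_in_second_image (X : {linear E -> E}) (phi : E) (c : seq K) :
  (forall psi, X (X psi) = 0 -> X psi = 0) -> has (fun a => a != 0) c ->
  \sum_(j < size c) c`_j *: iter j.+1 X phi = 0 ->
  exists psi, X (X psi) = X phi.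
Proof.
move=> ker; elim: c => //= a c IH /orP ac.
pose T := \sum_(j < size c) c`_j *: iter j X phi.
have XT : X T = \sum_(j < size c) c`_j *: iter j.+1 X phi.
  by rewrite linear_sum; apply: eq_bigr => j _; rewrite linearZ.
rewrite big_ord_recl/=.
under eq_bigr => j _ do rewrite -[X (X _)]/(X (iter j.+1 X phi)) -linearZ.
rewrite -linear_sum -XT.
have [a0|a0] := eqVneq a 0.
  rewrite a0 scale0r add0r => /ker; rewrite XT; apply: IH.
  by case: ac => //; rewrite a0 eqxx.
move=> /eqP; rewrite addrC addr_eq0 => /eqP XXT; exists (- a^-1 *: T).
by rewrite !linearZ/= XXT scalerN scaleNr opprK scalerA mulVf// scale1r.
Qed.

End linear_dependence.

Section maximum_principle.
Variables (R : realType) (n : nat) (M : ptopologicalType)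
  (A : smooth_atlas R n M).
Local Notation C := (smooth_fun A).
Hypothesis cM : compact [set: M].
Variable X : {linear C -> C}.
Hypothesis X_at_max : forall (f : C) x, (forall y, f y <= f x) -> X f x = 0.

(** Let s = 1 or s = -1, and let y be a maximum of N s X psi + psi.  Applying X
    there gives s X psi y = - N X (X psi) y <= 0.  If s X psi x > 0 for some x,
    then for N large this contradicts the maximality of y, because psi is
    bounded. *)
Lemma second_derivative_ge0_eq0 (psi : C) :
  (forall x, 0 <= X (X psi) x) -> X psi = 0.
Proof.
move=> q0; have [K KP] := smooth_fun_bounded cM psi.
have K0 : 0 <= K by apply: le_trans (KP point); exact: normr_ge0.
suff H (s : R) x : s * s = 1 -> s * X psi x <= 0.
  apply: smooth_funP => x; apply/eqP; rewrite eq_le.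
  have := H 1 x (mulr1 1); have := H (-1) x; rewrite mulrNN mulr1 => /(_ erefl).
  by rewrite mulN1r mul1r oppr_le0 => -> ->.
move=> ss; rewrite leNgt; apply/negP => c0.
(* psi oscillates by at most 2 K. *)
pose N := (2 * K + 1) / (s * X psi x).
have N0 : 0 < N by rewrite divr_gt0// ltr_wpDl// mulr_ge0.
have [y ymax] := smooth_fun_argmax cM ((N * s) *: X psi + psi).
have := X_at_max ymax; rewrite linearD linearZ.
rewrite !smooth_funE => Xy.
have py : s * X psi y <= 0.
  have -> : s * X psi y = - (N * X (X psi) y * (s * s)).
    by rewrite -[X psi y](addKr (N * s * X (X psi) y)) Xy; ring.
  by rewrite ss mulr1 oppr_le0 mulr_ge0// ltW.
have Nx : N * (s * X psi x) = 2 * K + 1 by rewrite /N mulfVK// gt_eqF.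
have := ymax x; have := mulr_ge0_le0 (ltW N0) py; rewrite !smooth_funE.
clearbody N; move: (KP x) (KP y); rewrite !ler_norml => /andP[? ?] /andP[? ?];
  lra.
Qed.

End maximum_principle.

Section constancy.
Variables (R : realType) (n : nat) (M : ptopologicalType)
  (A : smooth_atlas R n M).

Lemma differential_eq0_constant (f : smooth_fun A) : connected [set: M] ->
  (forall c x, charts A c -> cdom c x -> differential c f x = 0) ->
  forall x, f x = f point.
Proof.
move=> connM df0.
pose B : set M := f @^-1` [set f point].
suff : B = setT by move=> BT x; have : B x by rewrite BT.
apply: connM; first by exists point.
- exists B; rewrite ?setTI// openE => x Bx.
  have [c Ac cx] := charts_cover A x; have cu := cimg_cmap cx.
  have [e e0 eU] := cubeP (open_nbhs_nbhs (conj (@cimg_open _ _ _ c) cu)).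
  have fcube v : cube (cmap c x) e v -> loc c f v = loc c f (cmap c x).
    apply: constant_on_cube => [|w i /eU cw].
      apply: Ck_on_local => w /eU cw; exists (cimg c); split=> //.
      exact: smooth_fun_Ck.
    have /rowP/(_ i) := df0 c (cinv c w) Ac (cdom_cinv cw).
    by rewrite !mxE cinvK.
  have oQ := @open_cmap_preimage _ _ _ c _ (@cube_open _ _ (cmap c x) e).
  have nQ : nbhs x (cdom c `&` cmap c @^-1` cube (cmap c x) e).
    by apply: open_nbhs_nbhs; split=> //; split=> //; exact: cube_center.
  apply: filterS nQ => y [cy yQ]; have := fcube _ yQ.
  by rewrite /loc !cmapK// /B/= => ->.
- exists B; rewrite ?setTI//.
  apply: (@preimage_closed _ _ f); last exact: closed_eq.
  by move=> x _; exact: smooth_fun_continuous.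
Qed.

End constancy.

(** * The estimation algebra *)

Section estimation_algebra.
Variables (R : realType) (n : nat) (M : ptopologicalType)
  (A : smooth_atlas R n M) (m : nat).
Local Notation C := (smooth_fun A).
Variables (Lstar : C -> C) (h : 'I_m -> C).
Local Notation EA := (estimation_algebra Lstar h).

Lemma estimation_algebra_observation i : EA (multiplication (h i)).
Proof. by move=> S [_ genS]; apply: genS; right; exists i. Qed.

Lemma estimation_algebra_commutator D1 D2 :
  EA D1 -> EA D2 -> EA (op_commutator D1 D2).
Proof.
move=> E1 E2 S [lieS genS]; have [_ _ SC] := lieS.
by apply: SC; [apply: E1|apply: E2]; split.
Qed.

Variables (l : nat) (V : 'I_l -> C -> C).
Hypothesis Lstar2 : forall f g k,
  Lstar (f * (g * k)) - f * Lstar (g * k) - g * Lstar (f * k) +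
    f * (g * Lstar k) = carre_du_champ V f g * k.

(** The double commutator of L_0 with multiplications by f and g; the potential
    term of L_0 commutes with multiplications and drops out. *)
Lemma estimation_algebra_carre_du_champ f g :
  EA (multiplication f) -> EA (multiplication g) ->
  EA (multiplication (carre_du_champ V f g)).
Proof.
move=> Ef Eg.
pose L0 : C -> C := Lstar - multiplication (2^-1 *: \sum_i h i ^+ 2).
have E0 : EA L0 by move=> S [_ genS]; apply: genS; left.
have := estimation_algebra_commutator (estimation_algebra_commutator E0 Ef) Eg.
congr EA; apply/funext => k; rewrite /multiplication -Lstar2 /op_commutator.
have L0E p : L0 p = Lstar p - (2^-1 *: \sum_i h i ^+ 2) * p by [].
rewrite !L0E; apply: smooth_funP => x.
move: (2^-1 *: _) => H.
by rewrite !(smooth_fun_add, smooth_fun_opp, smooth_fun_mul); ring.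
Qed.

End estimation_algebra.

(** With X = Gamma (h i), multiplication by X^j (h i) lies in the algebra for
    all j; evaluating at the constant 1 turns operators into functions. *)
Lemma carre_du_champ_eq0_of_finite_dimensional (R : realType) (n : nat)
    (M : ptopologicalType) (A : smooth_atlas R n M) (l m : nat)
    (V : 'I_l -> smooth_fun A -> smooth_fun A) (h : 'I_m -> smooth_fun A)
    (Lstar : smooth_fun A -> smooth_fun A) (i : 'I_m) :
  compact [set: M] -> (forall a, vector_field (V a)) ->
  (forall f g k, Lstar (f * (g * k)) - f * Lstar (g * k) - g * Lstar (f * k) +
    f * (g * Lstar k) = carre_du_champ V f g * k) ->
  (exists k (e : 'I_k -> smooth_fun A -> smooth_fun A),
     forall D, estimation_algebra Lstar h D ->
       exists r : 'I_k -> R, D = \sum_j r j *: e j) ->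
  carre_du_champ V (h i) (h i) = 0.
Proof.
move=> cM Vv Lstar2 [k [e spane]].
have [X XE] : exists X : {linear smooth_fun A -> smooth_fun A},
    forall f, X f = carre_du_champ V (h i) f.
  pose X0 := carre_du_champ V (h i).
  have X0l : linear X0 by move=> r f g; exact: carre_du_champ_linear.
  pose X0L := GRing.isLinear.Build _ _ _ _ X0 X0l.
  by exists (HB.pack_for {linear smooth_fun A -> smooth_fun A} X0 X0L).
have X_at_max (f : smooth_fun A) x : (forall y, f y <= f x) -> X f x = 0.
  by rewrite XE; exact: carre_du_champ_at_max.
have X2 psi : (forall x, 0 <= X (X psi) x) -> X psi = 0.
  exact: second_derivative_ge0_eq0.
have EX j : estimation_algebra Lstar h (multiplication (iter j X (h i))).
  elim: j => [|j IH]; first exact: estimation_algebra_observation.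
  rewrite iterS XE; apply: (estimation_algebra_carre_du_champ Lstar2) => //.
  exact: estimation_algebra_observation.
have [c cn0 cX] : exists2 c : 'rV[R]_k.+1, c != 0 &
    \sum_(j < k.+1) c 0 j *: iter j.+1 X (h i) = 0.
  apply: (span_dependent (e := fun j => e j 1)) => j.
  have [r rE] := spane _ (EX j.+1); exists r.
  have := congr1 (fun D : smooth_fun A -> smooth_fun A => D 1) rE.
  by rewrite {1}/multiplication mulr1 fct_sumE.
have [psi psiE] : exists psi, X (X psi) = X (h i).
  apply: (image_in_second_image (c := [seq c 0 j | j <- enum 'I_k.+1])).
  - by move=> psi XX; apply: X2 => x; rewrite XX.
  - apply: contraR cn0 => /hasPn H; apply/eqP/rowP => j; rewrite mxE.
    apply/eqP; have := H (c 0 j); rewrite negbK; apply.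
    by apply: map_f; rewrite mem_enum.
  - rewrite size_map size_enum_ord -[RHS]cX; apply: eq_bigr => j _.
    by rewrite (nth_map j) ?size_enum_ord// nth_ord_enum.
rewrite -XE -psiE (X2 psi) ?linear0// => x.
by rewrite psiE XE; exact: carre_du_champ_ge0.
Qed.

Unset Implicit Arguments.

Theorem theorem1 (R : realType) (n : nat) (M : ptopologicalType)
    (A : smooth_atlas R n M) (l m : nat)
    (V0 : smooth_fun A -> smooth_fun A)
    (V : 'I_l -> smooth_fun A -> smooth_fun A)
    (h : 'I_m -> smooth_fun A)
    (d : measure_display) (Omega : measurableType d) (P : probability Omega R)
    (F : R -> set (set Omega)) (X : R -> Omega -> M)
    (W : 'I_l -> R -> Omega -> R) (Y B : 'I_m -> R -> Omega -> R)
    (g : chart R n M -> 'rV[R]_n -> 'M[R]_n)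
    (omega : {measure set (borel M) -> \bar R})
    (Lstar : smooth_fun A -> smooth_fun A) :
  closed_manifold A ->
  vector_field V0 ->
  (forall a, vector_field (V a)) ->
  signal_observation_model P V0 V h F X W Y B ->
  nondegenerate_operator (generator V0 V) ->
  attached_metric (generator V0 V) g ->
  riemannian_measure A g omega ->
  adjoint_operator omega (generator V0 V) Lstar ->
  ~ (exists v : 'rV[R]_m, forall x i, h i x = v 0 i) ->
  infinite_dimensional (estimation_algebra Lstar h).
Proof.
move=> [hM cM connM] V0v Vv _ _ gL og LstarP hnc [k [e [_ spane]]]; apply: hnc.
have ofin := riemannian_measure_finite V0v Vv hM cM gL og.
have opos := riemannian_measure_open_gt0 V0v Vv hM gL og.
have Lstar2 := adjoint_double_commutator cM ofin
  (fun O x => opos x O) V0v Vv LstarP.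
have Gh0 i : carre_du_champ V (h i) (h i) = 0.
  by apply: (carre_du_champ_eq0_of_finite_dimensional _ cM Vv Lstar2);
    exists k, e.
exists (\row_i h i point) => x i; rewrite mxE.
apply: differential_eq0_constant => // c y Ac cy.
have [a [La aP]] := gL c Ac.
apply: (differential_eq0 V0v Vv hM Ac La cy); last by rewrite Gh0.
by have [] := aP _ (cimg_cmap cy).
Qed.
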